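(* Let $U_1,U_2,U_3$ be three copies of the additive group of $\mathbb Q$, with fixed isomorphisms $x_i\colon\mathbb Q\to U_i$, and let $$\mathcal U_{\widetilde A_2}(\mathbb Q):=U_1*U_2*U_3/\langle\!\langle [U_i,[U_i,U_j]],\ i\neq j\in\{1,2,3\}\rangle\!\rangle .$$ Let $\varphi\colon \mathcal U_{\widetilde A_2}(\mathbb Q)\to \mathrm{SL}_3(\mathbb Q[t])$ be the group homomorphism determined, for all $a\in\mathbb Q$, by $$x_1(a)\mapsto\begin{pmatrix}1 & a & 0\\ 0 & 1 & 0\\ 0 & 0 & 1\end{pmatrix},\quad x_2(a)\mapsto\begin{pmatrix}1 & 0 & 0\\ 0 & 1 & a\\ 0 & 0 & 1\end{pmatrix},\quad x_3(a)\mapsto\begin{pmatrix}1 & 0 & 0\\ 0 & 1 & 0\\ a t & 0 & 1\end{pmatrix}.$$ Then the kernel of $\varphi$ coincides with $\gamma_\infty(\mathcal U_{\widetilde A_2}(\mathbb Q))$. Moreover, the subgroup of $\mathcal U_{\widetilde A_2}(\mathbb Q)$ generated by $[U_1,U_2]\cong\mathbb Q$ and $[U_2,U_3]\cong\mathbb Q$ is isomorphic to the free product $\mathbb Q*\mathbb Q$, whereas its image under $\varphi$ is isomorphic to the Heisenberg group over $\mathbb Q$. In particular, $\gamma_\infty(\mathcal U_{\widetilde A_2}(\mathbb Q))$ contains $[[U_1,U_2],[[U_1,U_2],[U_2,U_3]]]\neq\{e\}$. Hence the group $\mathcal U_{\widetilde A_2}(\mathbb Q)$ is not residually nilpotent.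
   Context: For a group $H$: $[g,h]=g^{-1}h^{-1}gh$; for subgroups $X,Y$ of $H$, $[X,Y]$ is the subgroup generated by all $[x,y]$ with $x\in X$, $y\in Y$; $\gamma_1(H)=H$, $\gamma_{n+1}(H)=[H,\gamma_n(H)]$, and $\gamma_\infty(H)=\bigcap_{n\ge1}\gamma_n(H)$ is the nilpotent residual. $\langle\!\langle\cdot\rangle\!\rangle$ denotes normal closure. $H$ is residually nilpotent if every non-trivial element has non-trivial image in some nilpotent quotient of $H$. In the quotient group, $U_i$ denotes the image of $U_i$. The Heisenberg group over $\mathbb Q$ is the group of upper unitriangular $3\times3$ matrices over $\mathbb Q$. *)

(* Defs.v *)
(* Groups are MathComp's possibly infinite [groupType]s; their subsets are the
   classical sets of MathComp-classical. *)
From HB Require Import structures.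
From mathcomp Require Import all_boot all_order all_algebra.
From mathcomp Require Import boolp classical_sets functions.
From mathcomp Require Import ring.

Set Implicit Arguments.
Unset Strict Implicit.
Unset Printing Implicit Defensive.

Import GRing.Theory.
Local Open Scope quotient_scope.
Local Open Scope classical_set_scope.
Local Open Scope group_scope.

Section Subgroups.
Variable G : groupType.
Implicit Types (S X Y A : set G).

Definition is_subgroup A := A 1 /\ forall x y, A x -> A y -> A (x / y).

Definition is_normal_subgroup A :=
  is_subgroup A /\ forall x y, A x -> A (x ^ y).

Definition generated S : set G := smallest is_subgroup S.

Definition normal_closure S : set G := smallest is_normal_subgroup S.

(* MathComp's [~ x, y] is x^-1 * (y^-1 * (x * y)). *)
Definition commutator X Y : set G :=
  generated [set [~ x, y] | x in X & y in Y].

(* [lcs n] is gamma_n for n >= 1; [lcs 0] is a dummy value. *)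
Fixpoint lcs (n : nat) : set G :=
  if n is m.+1 then
    if m is 0 then setT else commutator setT (lcs m)
  else setT.

Definition nilpotent_residual : set G :=
  \bigcap_(n in [set n | (1 <= n)%N]) lcs n.

Definition is_nilpotent := exists2 n, (1 <= n)%N & lcs n = [set 1].

Lemma subgroupV A x : is_subgroup A -> A x -> A x^-1.
Proof. by case=> A1 AF Ax; rewrite -div1g; apply: AF. Qed.

Lemma subgroupM A x y : is_subgroup A -> A x -> A y -> A (x * y).
Proof.
by move=> HA Ax Ay; rewrite -[y]invgK; apply: HA.2 => //; apply: subgroupV.
Qed.

Lemma normal_closure_normal S : is_normal_subgroup (normal_closure S).
Proof.
split; [split|].
- by move=> A [[[]]].
- move=> x y Sx Sy A HA; apply: HA.1.1.2; [exact: Sx | exact: Sy].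
- move=> x y Sx A HA; apply: HA.1.2; exact: Sx.
Qed.

End Subgroups.

Arguments lcs G n : clear implicits.
Arguments nilpotent_residual G : clear implicits.

(* An isomorphism between subsets A and B, meant for subgroups. The values of f
   outside A are irrelevant. *)
Definition isomorphic (G H : groupType) (A : set G) (B : set H) :=
  exists2 f : G -> H,
    set_bij A B f & forall x y, A x -> A y -> f (x * y) = f x * f y.

Definition ker (G H : groupType) (f : G -> H) : set G := f @^-1` [set 1].

Lemma ker_normal (G H : groupType) (f : UMagmaMorphism.type G H) :
  is_normal_subgroup (ker f).
Proof.
split; [split|]; rewrite /ker /=.
- exact: gmulf1.
- by move=> x y fx fy; rewrite gmulfF fx fy invg1 mulg1.
- by move=> x y fx; rewrite gmulfJ fx conj1g.
Qed.

Record normalSubgroup (G : groupType) := NormalSubgroup {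
  normal_set :> set G;
  normal_setP : is_normal_subgroup normal_set
}.

Definition normal_closure_group (G : groupType) (S : set G) : normalSubgroup G :=
  NormalSubgroup (normal_closure_normal S).

Section Quotient.
Variables (G : groupType) (N : normalSubgroup G).

Definition coset_eq : rel G := fun x y => `[< normal_set N (x^-1 * y) >].

Lemma coset_eqP x y : reflect (normal_set N (x^-1 * y)) (coset_eq x y).
Proof. exact: asboolP. Qed.

Lemma coset_eq_refl : reflexive coset_eq.
Proof. by move=> x; apply/coset_eqP; rewrite mulVg; case: (normal_setP N) => -[]. Qed.

Lemma coset_eq_sym : symmetric coset_eq.
Proof.
have [sN _] := normal_setP N.
move=> x y; apply/coset_eqP/coset_eqP => /(subgroupV sN);
  by rewrite invgM invgK.
Qed.

Lemma coset_eq_trans : transitive coset_eq.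
Proof.
have [sN _] := normal_setP N.
move=> y x z /coset_eqP xy /coset_eqP yz; apply/coset_eqP.
by have := subgroupM sN xy yz; rewrite -mulgA mulVKg.
Qed.

Definition coset_equiv :=
  EquivRel coset_eq coset_eq_refl coset_eq_sym coset_eq_trans.

Definition quotient_group := {eq_quot coset_equiv}.
HB.instance Definition _ := Choice.on quotient_group.
HB.instance Definition _ := EqQuotient.on quotient_group.

Definition quotient_map (x : G) : quotient_group := \pi x.

Lemma quotient_map_eq x y :
  quotient_map x = quotient_map y <-> normal_set N (x^-1 * y).
Proof. by split=> [/eqmodP/coset_eqP|xy]; last exact/eqmodP/coset_eqP. Qed.

Lemma repr_quotient_map x : normal_set N ((repr (quotient_map x))^-1 * x).
Proof. by apply/quotient_map_eq; rewrite /quotient_map reprK. Qed.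

Definition quotient_mul (x y : quotient_group) := quotient_map (repr x * repr y).
Definition quotient_inv (x : quotient_group) := quotient_map (repr x)^-1.

Lemma quotient_mapM x y :
  quotient_map (x * y) = quotient_mul (quotient_map x) (quotient_map y).
Proof.
have [sN nN] := normal_setP N.
apply/esym/quotient_map_eq.
set b := repr (quotient_map y).
have := subgroupM sN (nN _ b (repr_quotient_map x)) (repr_quotient_map y).
by rewrite -/b /conjg invgM -!mulgA mulVKg.
Qed.

Lemma quotient_mapV x : quotient_map x^-1 = quotient_inv (quotient_map x).
Proof.
have [sN nN] := normal_setP N.
apply/esym/quotient_map_eq; rewrite invgK.
have := nN _ x^-1 (subgroupV sN (repr_quotient_map x)).
set a := repr _; rewrite /conjg invgK invgM invgK => H.
by move: H; rewrite !mulgA mulgV mul1g.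
Qed.

Lemma quotient_mapK x : quotient_map (repr x) = x.
Proof. exact: reprK. Qed.

Lemma quotient_mulA : associative quotient_mul.
Proof.
move=> x y z; rewrite -[x]quotient_mapK -[y]quotient_mapK -[z]quotient_mapK.
by rewrite -!quotient_mapM mulgA.
Qed.

Lemma quotient_mul1 : left_id (quotient_map 1) quotient_mul.
Proof. by move=> x; rewrite -[x]quotient_mapK -quotient_mapM mul1g. Qed.

Lemma quotient_mulr1 : right_id (quotient_map 1) quotient_mul.
Proof. by move=> x; rewrite -[x]quotient_mapK -quotient_mapM mulg1. Qed.

Lemma quotient_mulV : left_inverse (quotient_map 1) quotient_inv quotient_mul.
Proof.
by move=> x; rewrite -[x]quotient_mapK -quotient_mapV -quotient_mapM mulVg.
Qed.

Lemma quotient_mulrV : right_inverse (quotient_map 1) quotient_inv quotient_mul.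
Proof.
by move=> x; rewrite -[x]quotient_mapK -quotient_mapV -quotient_mapM mulgV.
Qed.

HB.instance Definition _ := isGroup.Build quotient_group
  quotient_mulA quotient_mul1 quotient_mulr1 quotient_mulV quotient_mulrV.

Lemma quotient_mapF : {morph quotient_map : x y / x / y}.
Proof. by move=> x y; rewrite quotient_mapM quotient_mapV. Qed.

HB.instance Definition _ :=
  isGroupMorphism.Build G quotient_group quotient_map quotient_mapF.

Section Lift.
Variables (H : groupType) (f : UMagmaMorphism.type G H).
Hypothesis kN : N `<=` ker f.

Definition quotient_lift of N `<=` ker f := fun x : quotient_group => f (repr x).

Lemma quotient_lift_map x : quotient_lift kN (quotient_map x) = f x.
Proof.
have := kN (repr_quotient_map x); rewrite /ker /= gmulfM gmulfV => /mulg1_eq.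
by rewrite invgK.
Qed.

Lemma quotient_liftF : {morph quotient_lift kN : x y / x / y}.
Proof.
move=> x y; rewrite -[x]quotient_mapK -[y]quotient_mapK.
by rewrite -quotient_mapF !quotient_lift_map gmulfF.
Qed.

HB.instance Definition _ :=
  isGroupMorphism.Build quotient_group H (quotient_lift kN) quotient_liftF.

End Lift.

End Quotient.

(* The factor F_i is realized by the letters (i, a), a in F_i; a word is a
   finite sequence of letters. *)
Section FreeProduct.
Variables (I : choiceType) (F : I -> groupType).

Definition letter (i : I) (a : F i) : {j : I & F j} := Tagged F a.

(* The smallest congruence on words that deletes trivial letters and multiplies
   adjacent letters of the same factor. *)
Inductive word_eq : seq {i : I & F i} -> seq {i : I & F i} -> Prop :=
| WordRefl w : word_eq w w
| WordSym v w : word_eq v w -> word_eq w v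
| WordTrans u v w : word_eq u v -> word_eq v w -> word_eq u w
| WordCat v v' w w' : word_eq v v' -> word_eq w w' -> word_eq (v ++ w) (v' ++ w')
| WordOne i : word_eq [:: letter (1 : F i)] [::]
| WordMul i (a b : F i) : word_eq [:: letter a; letter b] [:: letter (a * b)].

Definition word_eqb : rel (seq {i : I & F i}) := fun v w => `[< word_eq v w >].

Lemma word_eqP v w : reflect (word_eq v w) (word_eqb v w).
Proof. exact: asboolP. Qed.

Lemma word_eqb_refl : reflexive word_eqb.
Proof. by move=> w; apply/word_eqP/WordRefl. Qed.

Lemma word_eqb_sym : symmetric word_eqb.
Proof. by move=> v w; apply/word_eqP/word_eqP => /WordSym. Qed.

Lemma word_eqb_trans : transitive word_eqb.
Proof. by move=> v u w /word_eqP uv /word_eqP vw; apply/word_eqP/(WordTrans uv). Qed.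

Definition word_equiv :=
  EquivRel word_eqb word_eqb_refl word_eqb_sym word_eqb_trans.

Definition free_product := {eq_quot word_equiv}.
HB.instance Definition _ := Choice.on free_product.
HB.instance Definition _ := EqQuotient.on free_product.

Definition fp_word (w : seq {i : I & F i}) : free_product := \pi w.

Lemma fp_word_eq v w : fp_word v = fp_word w <-> word_eq v w.
Proof. by split=> [/eqmodP/word_eqP|vw]; last exact/eqmodP/word_eqP. Qed.

Lemma fp_wordK x : fp_word (repr x) = x.
Proof. exact: reprK. Qed.

Definition inv_word (w : seq {i : I & F i}) :=
  rev [seq @letter (tag t) (tagged t)^-1 | t : {i : I & F i} <- w].

Lemma inv_word_eq v w : word_eq v w -> word_eq (inv_word v) (inv_word w).
Proof.
rewrite /inv_word; elim=> {v w}.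
- by move=> w; apply: WordRefl.
- by move=> v w _; apply: WordSym.
- by move=> u v w _ uv _; apply: WordTrans.
- by move=> v v' w w' _ vv _ ww; rewrite !map_cat !rev_cat; apply: WordCat.
- by move=> i; rewrite /= /rev /= invg1; apply: WordOne.
- by move=> i a b; rewrite /= /rev /= invgM; apply: WordMul.
Qed.

Lemma inv_wordM w : word_eq (inv_word w ++ w) [::].
Proof.
elim: w => [|[i a] w IHw]; first exact: WordRefl.
rewrite /inv_word /= rev_cons cat_rcons -/(inv_word w).
apply: WordTrans IHw.
apply: WordCat (WordRefl _) _.
rewrite -[X in word_eq _ X]cat0s -cat1s -[X in _ ++ X]cat1s catA.
apply: WordCat (WordRefl _).
apply: WordTrans (WordOne i).
by rewrite -(mulVg a); apply: WordMul.
Qed.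

Lemma inv_wordK : involutive inv_word.
Proof.
move=> w; rewrite /inv_word map_rev revK -map_comp -[RHS]map_id.
by apply: eq_map => -[i a] /=; rewrite invgK.
Qed.

Definition fp_mul (x y : free_product) := fp_word (repr x ++ repr y).
Definition fp_inv (x : free_product) := fp_word (inv_word (repr x)).

Lemma fp_wordM v w : fp_word (v ++ w) = fp_mul (fp_word v) (fp_word w).
Proof. by apply/esym/fp_word_eq/WordCat; apply/fp_word_eq; rewrite fp_wordK. Qed.

Lemma fp_wordV w : fp_word (inv_word w) = fp_inv (fp_word w).
Proof. by apply/esym/fp_word_eq/inv_word_eq/fp_word_eq; rewrite fp_wordK. Qed.

Lemma fp_mulA : associative fp_mul.
Proof.
move=> x y z; rewrite -[x]fp_wordK -[y]fp_wordK -[z]fp_wordK.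
by rewrite -!fp_wordM catA.
Qed.

Lemma fp_mul1 : left_id (fp_word [::]) fp_mul.
Proof. by move=> x; rewrite -[x]fp_wordK -fp_wordM. Qed.

Lemma fp_mulr1 : right_id (fp_word [::]) fp_mul.
Proof. by move=> x; rewrite -[x]fp_wordK -fp_wordM cats0. Qed.

Lemma fp_mulV : left_inverse (fp_word [::]) fp_inv fp_mul.
Proof.
move=> x; rewrite -[x]fp_wordK -fp_wordV -fp_wordM.
exact/fp_word_eq/inv_wordM.
Qed.

Lemma fp_mulrV : right_inverse (fp_word [::]) fp_inv fp_mul.
Proof.
move=> x; rewrite -[x]fp_wordK -fp_wordV -fp_wordM; apply/fp_word_eq.
by have := inv_wordM (inv_word (repr x)); rewrite inv_wordK.
Qed.

HB.instance Definition _ := isGroup.Build free_product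
  fp_mulA fp_mul1 fp_mulr1 fp_mulV fp_mulrV.

Definition fp_inj (i : I) (a : F i) : free_product := fp_word [:: letter a].

Lemma fp_injM i : {morph @fp_inj i : a b / a * b}.
Proof.
move=> a b; transitivity (fp_word ([:: letter a] ++ [:: letter b])).
  exact/esym/fp_word_eq/WordMul.
exact: fp_wordM.
Qed.

Lemma fp_inj1 i : fp_inj (1 : F i) = 1.
Proof. exact/fp_word_eq/WordOne. Qed.

Lemma fp_injF i : {morph @fp_inj i : a b / a / b}.
Proof.
move=> a b; rewrite fp_injM; congr (_ * _).
by apply/esym/mulg1_eq; rewrite -fp_injM mulgV fp_inj1.
Qed.

HB.instance Definition _ i :=
  isGroupMorphism.Build (F i) free_product (@fp_inj i) (@fp_injF i).

Section Lift.
Variables (H : groupType) (f : forall i, UMagmaMorphism.type (F i) H).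

Definition eval_word (w : seq {i : I & F i}) : H :=
  \prod_(t <- w) f (tag t) (tagged t).

Lemma eval_word_eq v w : word_eq v w -> eval_word v = eval_word w.
Proof.
rewrite /eval_word; elim=> {v w} //.
- by move=> u v w _ -> _ ->.
- by move=> v v' w w' _ vv _ ww; rewrite !big_cat /= vv ww.
- by move=> i; rewrite big_seq1 big_nil gmulf1.
- by move=> i a b; rewrite big_cons !big_seq1 gmulfM.
Qed.

Definition fp_lift (x : free_product) : H := eval_word (repr x).

Lemma fp_lift_word w : fp_lift (fp_word w) = eval_word w.
Proof. by apply/eval_word_eq/fp_word_eq; rewrite fp_wordK. Qed.

Lemma fp_lift_inj i (a : F i) : fp_lift (fp_inj a) = f i a.
Proof. by rewrite fp_lift_word /eval_word big_seq1. Qed.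

Lemma fp_liftM : {morph fp_lift : x y / x * y}.
Proof.
move=> x y; rewrite -[x]fp_wordK -[y]fp_wordK -[_ * _]fp_wordM !fp_lift_word.
by rewrite /eval_word big_cat.
Qed.

Lemma fp_liftF : {morph fp_lift : x y / x / y}.
Proof.
move=> x y; rewrite fp_liftM; congr (_ * _).
apply/esym/mulg1_eq; rewrite -fp_liftM mulgV.
by rewrite (fp_lift_word [::]) /eval_word big_nil.
Qed.

HB.instance Definition _ :=
  isGroupMorphism.Build free_product H fp_lift fp_liftF.

End Lift.

End FreeProduct.

Arguments free_product {I} F.
Arguments fp_inj {I} F i a.

Definition residually_nilpotent (G : groupType) :=
  forall g : G, g <> 1 ->
    exists2 N : normalSubgroup G,
      is_nilpotent (quotient_group N) & quotient_map N g <> 1.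

Section SpecialLinear.
Variables (R : comNzRingType) (n : nat).

Record SL := MkSL { SLval :> 'M[R]_n; _ : (\det SLval == 1)%R }.

HB.instance Definition _ := [isSub for SLval].
HB.instance Definition _ := [Choice of SL by <:].

Lemma det_SL (A : SL) : (\det A = 1)%R.
Proof. by case: A => A /= /eqP. Qed.

Fact SL_one_subproof : (\det (1%:M : 'M[R]_n) == 1)%R.
Proof. by rewrite det1. Qed.

Fact SL_mul_subproof (A B : SL) : (\det (A *m B) == 1)%R.
Proof. by rewrite det_mulmx !det_SL mulr1. Qed.

Lemma SL_mulVmx (A : SL) : (\adj A *m A)%R = 1%:M%R.
Proof. by rewrite mul_adj_mx det_SL. Qed.

Fact SL_inv_subproof (A : SL) : (\det (\adj A) == 1)%R.
Proof.
by have := congr1 determinant (SL_mulVmx A); rewrite det_mulmx det_SL det1 mulr1 => ->.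
Qed.

Definition SL_one := MkSL SL_one_subproof.
Definition SL_mul (A B : SL) := MkSL (SL_mul_subproof A B).
Definition SL_inv (A : SL) := MkSL (SL_inv_subproof A).

Lemma SL_mulA : associative SL_mul.
Proof. by move=> A B C; apply: val_inj; rewrite /= mulmxA. Qed.

Lemma SL_mul1 : left_id SL_one SL_mul.
Proof. by move=> A; apply: val_inj; rewrite /= mul1mx. Qed.

Lemma SL_mulr1 : right_id SL_one SL_mul.
Proof. by move=> A; apply: val_inj; rewrite /= mulmx1. Qed.

Lemma SL_mulV : left_inverse SL_one SL_inv SL_mul.
Proof. by move=> A; apply: val_inj; rewrite /= SL_mulVmx. Qed.

Lemma SL_mulrV : right_inverse SL_one SL_inv SL_mul.
Proof. by move=> A; apply: val_inj; rewrite /= mul_mx_adj det_SL. Qed.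

HB.instance Definition _ := isGroup.Build SL
  SL_mulA SL_mul1 SL_mulr1 SL_mulV SL_mulrV.

End SpecialLinear.

(* The additive group of the rationals, as a multiplicatively written group. *)
Definition Qadd : groupType := Algebra.to_multiplicative rat.

Definition Q_free_Q : groupType := free_product (fun _ : bool => Qadd).

(* As a subset of SL_3(Q): upper unitriangular matrices have determinant 1. *)
Definition heisenberg : set (SL rat 3) :=
  [set A | forall i j : 'I_3, (j <= i)%N -> (A i j = (i == j)%:R)%R].

(* The index set {1, 2, 3} is rendered as 'I_3 = {0, 1, 2}: U_i and x_i are
   [Usub] and [xgen] at index i - 1. *)
Definition U_copies : groupType := free_product (fun _ : 'I_3 => Qadd).

Definition U_factor (i : 'I_3) : set U_copies :=
  range (fp_inj (fun _ : 'I_3 => Qadd) i).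

Definition U_relators : set U_copies :=
  \bigcup_(p in [set p : 'I_3 * 'I_3 | p.1 != p.2])
    commutator (U_factor p.1) (commutator (U_factor p.1) (U_factor p.2)).

Definition U_A2t : groupType :=
  quotient_group (normal_closure_group U_relators).

Definition xgen (i : 'I_3) (a : Qadd) : U_A2t :=
  quotient_map _ (fp_inj (fun _ : 'I_3 => Qadd) i a).

Definition Usub (i : 'I_3) : set U_A2t := range (xgen i).

Definition U1 := Usub (@Ordinal 3 0 isT).
Definition U2 := Usub (@Ordinal 3 1 isT).
Definition U3 := Usub (@Ordinal 3 2 isT).

Definition U12_23 : set U_A2t :=
  generated (commutator U1 U2 `|` commutator U2 U3).

Definition mx3 (R : nzRingType) (rows : seq (seq R)) : 'M[R]_3 :=
  (\matrix_(i, j) nth 0 (nth [::] rows i) j)%R.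

Definition phi_mx (i : 'I_3) (a : rat) : 'M[{poly rat}]_3 :=
  (match val i with
   | 0 => mx3 [:: [:: 1; a%:P; 0];
                  [:: 0;    1; 0];
                  [:: 0;    0; 1]]
   | 1 => mx3 [:: [:: 1; 0;    0];
                  [:: 0; 1; a%:P];
                  [:: 0; 0;    1]]
   | _ => mx3 [:: [::        1; 0; 0];
                  [::        0; 1; 0];
                  [:: a *: 'X; 0; 1]]
   end)%R.

Lemma mx3M (R : nzRingType) (a b c d e f g h i a' b' c' d' e' f' g' h' i' : R) :
  (mx3 [:: [:: a; b; c]; [:: d; e; f]; [:: g; h; i]] *m
   mx3 [:: [:: a'; b'; c']; [:: d'; e'; f']; [:: g'; h'; i']] =
   mx3 [:: [:: a * a' + b * d' + c * g'; a * b' + b * e' + c * h';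
               a * c' + b * f' + c * i'];
           [:: d * a' + e * d' + f * g'; d * b' + e * e' + f * h';
               d * c' + e * f' + f * i'];
           [:: g * a' + h * d' + i * g'; g * b' + h * e' + i * h';
               g * c' + h * f' + i * i']])%R.
Proof.
apply/matrixP => -[[|[|[|//]]] ?] [[|[|[|//]]] ?];
  by rewrite !mxE !big_ord_recl big_ord0 !mxE /= addr0 addrA.
Qed.

Lemma mx3_1 (R : nzRingType) :
  (1%:M = mx3 [:: [:: 1; 0; 0]; [:: 0; 1; 0]; [:: 0; 0; 1]] :> 'M[R]_3)%R.
Proof. by apply/matrixP => -[[|[|[|//]]] ?] [[|[|[|//]]] ?]; rewrite !mxE. Qed.

Lemma det_phi_mx i a : (\det (phi_mx i a) == 1)%R.
Proof.
apply/eqP; case: i => -[|[|[|//]]] lti; rewrite /phi_mx /=.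
- rewrite -det_tr det_trig; last first.
    by apply/is_trig_mxP => -[[|[|[|//]]] ?] [[|[|[|//]]] ?]; rewrite !mxE.
  by rewrite !big_ord_recl big_ord0 !mxE /= !mulr1.
- rewrite -det_tr det_trig; last first.
    by apply/is_trig_mxP => -[[|[|[|//]]] ?] [[|[|[|//]]] ?]; rewrite !mxE.
  by rewrite !big_ord_recl big_ord0 !mxE /= !mulr1.
- rewrite det_trig; last first.
    by apply/is_trig_mxP => -[[|[|[|//]]] ?] [[|[|[|//]]] ?]; rewrite !mxE.
  by rewrite !big_ord_recl big_ord0 !mxE /= !mulr1.
Qed.

Definition phi_gen (i : 'I_3) (a : Qadd) : SL {poly rat} 3 :=
  MkSL (det_phi_mx i a).

Lemma phi_mxD i a b : (phi_mx i (a + b) = phi_mx i a *m phi_mx i b)%R.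
Proof.
by case: i => -[|[|[|//]]] lti; rewrite /phi_mx /= mx3M;
  do ![congr (mx3 _) | congr (_ :: _)];
  rewrite ?polyCD ?scalerDl ?mul0r ?mulr0 ?mul1r ?mulr1 ?addr0 ?add0r // addrC.
Qed.

Lemma phi_mx0 i : (phi_mx i 0 = 1%:M)%R.
Proof.
by case: i => -[|[|[|//]]] lti; rewrite /phi_mx /= mx3_1 ?scale0r.
Qed.

Lemma phi_genF i : {morph phi_gen i : a b / a / b}.
Proof.
have phiM : {morph phi_gen i : a b / a * b}.
  by move=> a b; apply: val_inj; apply: phi_mxD.
move=> a b; rewrite phiM; congr (_ * _); apply/esym/mulg1_eq.
by rewrite -phiM mulgV; apply: val_inj; apply: phi_mx0.
Qed.

HB.instance Definition _ i :=
  isGroupMorphism.Build Qadd (SL {poly rat} 3) (phi_gen i) (phi_genF i).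

Definition phi_free : U_copies -> SL {poly rat} 3 :=
  fp_lift (fun i => phi_gen i : UMagmaMorphism.type _ _).

HB.instance Definition _ := UMagmaMorphism.on phi_free.

Definition root_mx (R : nzRingType) (i : 'I_3) (a : R) : 'M[R]_3 :=
  (match val i with
   | 0 => mx3 [:: [:: 1; a; 0]; [:: 0; 1; 0]; [:: 0; 0; 1]]
   | 1 => mx3 [:: [:: 1; 0; 0]; [:: 0; 1; a]; [:: 0; 0; 1]]
   | _ => mx3 [:: [:: 1; 0; 0]; [:: 0; 1; 0]; [:: a; 0; 1]]
   end)%R.

Lemma root_mx_comm (R : comNzRingType) i j (a b c : R) : i != j ->
  (root_mx i a *m (root_mx i (- b) *m (root_mx j (- c) *m
     (root_mx i b *m root_mx j c))) =
   (root_mx i (- b) *m (root_mx j (- c) *m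
     (root_mx i b *m root_mx j c))) *m root_mx i a)%R.
Proof.
case: i => -[|[|[|//]]] lti; case: j => -[|[|[|//]]] ltj //= _;
  rewrite /root_mx /= !mx3M;
  do ![congr (mx3 _) | congr (_ :: _)]; ring.
Qed.

Definition phi_entry (i : 'I_3) (a : rat) : {poly rat} :=
  (if val i is 2 then a *: 'X else a%:P)%R.

Lemma phi_entryN i a : (phi_entry i (- a) = - phi_entry i a)%R.
Proof. by case: i => -[|[|[|//]]] ?; rewrite /phi_entry /= ?scaleNr ?polyCN. Qed.

Lemma phi_mxE i a : phi_mx i a = root_mx i (phi_entry i a).
Proof. by case: i => -[|[|[|//]]]. Qed.

Lemma phi_gen_comm i j a b c : i != j ->
  commute (phi_gen i a) [~ phi_gen i b, phi_gen j c].
Proof.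
move=> neq_ij; rewrite /commute /commg /conjg -!gmulfV.
apply: val_inj; rewrite /= !phi_mxE !(phi_entryN _ (_ : rat)).
exact: root_mx_comm.
Qed.

Lemma generated_sub (G : groupType) (S A : set G) :
  is_subgroup A -> S `<=` A -> generated S `<=` A.
Proof. by move=> sA SA x; apply. Qed.

Lemma phi_free_inj i a : phi_free (fp_inj _ i a) = phi_gen i a.
Proof. exact: fp_lift_inj. Qed.

Lemma phi_free_relators : normal_closure U_relators `<=` ker phi_free.
Proof.
move=> x; apply; split; first exact: ker_normal.
move=> {x} u [[i j] /= neq_ij].
apply: generated_sub; first by case: (ker_normal phi_free).
move=> _ [_ [a _ <-] [y Cy <-]].
rewrite /ker /=; apply/eqP; rewrite gmulfR /= phi_free_inj; apply/commgP.
move: y Cy; apply: generated_sub.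
  split; rewrite /= ?gmulf1 ?commute1 //; first exact: commute1.
  by move=> y z Cy Cz; rewrite gmulfF; apply: commuteM => //; apply: commuteV.
move=> _ [_ [b _ <-] [_ [c _ <-] <-]] /=.
by rewrite gmulfR /= !phi_free_inj; apply: phi_gen_comm.
Qed.

(* [phi_xgen] and [phi_unique] below show that phi is the homomorphism
   determined by [phi_mx]. *)
Definition phi : U_A2t -> SL {poly rat} 3 :=
  @quotient_lift U_copies (normal_closure_group U_relators) _ phi_free
    phi_free_relators.

HB.instance Definition _ := UMagmaMorphism.on phi.

Lemma phi_xgen i a : SLval (phi (xgen i a)) = phi_mx i a.
Proof. by rewrite /phi /xgen quotient_lift_map /= phi_free_inj. Qed.

Lemma phi_unique (psi : UMagmaMorphism.type U_A2t (SL {poly rat} 3)) :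
  (forall i a, SLval (psi (xgen i a)) = phi_mx i a) -> psi =1 phi.
Proof.
move=> psi_x x; rewrite -[x]quotient_mapK -[repr x]fp_wordK.
elim: (repr (repr x)) => [|[i a] w IHw].
  by rewrite (_ : quotient_map _ _ = 1) ?gmulf1.
have -> : fp_word (@letter _ (fun _ : 'I_3 => Qadd) i a :: w) =
    (fp_inj (fun _ : 'I_3 => Qadd) i a : U_copies) * fp_word w.
  exact: (@fp_wordM _ (fun _ : 'I_3 => Qadd) [:: letter a] w).
rewrite gmulfM !gmulfM IHw; congr (_ * _).
by apply: val_inj; rewrite /= psi_x phi_xgen.
Qed.

(* Main.v *)
Require Import Defs.
From HB Require Import structures.
From mathcomp Require Import all_boot all_order all_algebra.
From mathcomp Require Import boolp classical_sets functions.
From mathcomp Require Import ring lra zify.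

(** The kernel of phi. Conjugating phi(g)(t := X^3) by diag(X^2, X, 1) gives a
    representation psi in which every x_i(a) is 1 + a X E_i, where
    E_1 = E12, E_2 = E23, E_3 = E31. Since [1 + X^p A, 1 + X^q B] is congruent to
    1 + X^(p+q) (AB - BA) modulo X^(p+q+1), gamma_n maps into 1 + (X^n), so the
    residual lies in the kernel. Conversely, the graded Lie ring of the lower
    central series is generated by three copies of Q subject to the Serre relations
    of affine type A2; a direct computation with these relations shows that its
    components of degree 3m+1, 3m+2, 3m+3 are spanned by families with 3, 3 and
    2 rational parameters, which the leading coefficient of psi separates. Hence
    an element of the kernel that lies in gamma_n lies in gamma_(n+1).

    The free product. The group is the fundamental group of a triangle of groups
    whose vertex groups are Heisenberg groups, with links of girth 6, hence
    nonpositively curved. Its development is built explicitly, layer by layer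
    around a vertex, as a set of chambers on which U_1, U_2, U_3 act; the
    relations hold because the action can be read in charts modelled on the
    Heisenberg group. An alternating word in Z_12 = [U_1, U_2] and
    Z_23 = [U_2, U_3] moves the base chamber away from the base vertex at each
    letter, so it acts nontrivially. *)

Set Implicit Arguments.
Unset Strict Implicit.
Unset Printing Implicit Defensive.

Import Order.TTheory GRing.Theory Num.Theory.

(** * A positively graded Lie ring with the affine A2 Serre relations *)

Section BiadditiveRat.
Local Open Scope group_scope.
Variables (H : groupType) (f : rat -> rat -> H).
Hypothesis fDl : forall a a' b, f (a + a')%R b = f a b * f a' b.
Hypothesis fDr : forall a b b', f a (b + b')%R = f a b * f a b'.

(** Integers pass from one argument to the other, and b is divisible by the denominator of a: the
    tensor product of Q with itself over Z is Q. *)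
Lemma biadditive_rat a b : f a b = f 1%R (a * b)%R.
Proof.
have f0l b' : f 0%R b' = 1.
  by apply: (mulgI (f 0%R b')); rewrite -fDl addr0 mulg1.
have f0r a' : f a' 0%R = 1.
  by apply: (mulgI (f a' 0%R)); rewrite -fDr addr0 mulg1.
have fn n x y : f (x *+ n)%R y = f x (y *+ n)%R.
  elim: n => [|n IHn]; first by rewrite !mulr0n f0l f0r.
  by rewrite !mulrS fDl fDr IHn.
have fN x y : f (- x)%R y = f x (- y)%R.
  have -> : f (- x)%R y = (f x y)^-1.
    by apply/esym/mulg1_eq; rewrite -fDl subrr f0l.
  by apply: mulg1_eq; rewrite -fDr subrr f0r.
have fz (z : int) x y : f (x *~ z)%R y = f x (y *~ z)%R.
  case: z => n; first exact: fn.
  by rewrite NegzE !mulrNz -!pmulrn fN fn mulNrn.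
have dn0 : ((denq a)%:~R != 0 :> rat)%R by rewrite intr_eq0 denq_neq0.
have -> : (a * b = (b / (denq a)%:~R) *~ numq a)%R.
  by rewrite -mulrzr -[X in (X * b)%R]divq_num_den; field.
rewrite -fz.
have {1}-> : (b = (b / (denq a)%:~R) *~ denq a)%R.
  by rewrite -mulrzr mulfVK.
rewrite -fz; congr (f _ _).
by rewrite -mulrzr -{1}[a]divq_num_den mulfVK.
Qed.

End BiadditiveRat.

Section AffineNilpotent.
Local Open Scope ring_scope.
(* [br p q n] is meaningful only for n = p + q; leaving n free avoids casts. *)
Variables (gr : nat -> zmodType) (br : forall p q n, gr p -> gr q -> gr n).
Hypothesis brDl : forall p q n x x' y, n = (p + q)%N ->
  @br p q n (x + x') y = br n x y + br n x' y.
Hypothesis brDr : forall p q n x y y', n = (p + q)%N ->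
  @br p q n x (y + y') = br n x y + br n x y'.
Hypothesis brC : forall p q n x y, n = (p + q)%N ->
  @br p q n x y = - @br q p n y x.
Hypothesis brJ : forall p q r pq pr qr n x y z,
  pq = (p + q)%N -> pr = (p + r)%N -> qr = (q + r)%N -> n = (p + q + r)%N ->
  @br p qr n x (@br q r qr y z) =
  @br pq r n (@br p q pq x y) z + @br q pr n y (@br p r pr x z).

Variables (I : eqType) (s : I -> I).
Hypothesis s3 : forall i, s (s (s i)) = i.
Variable e : I -> rat -> gr 1.
Hypothesis eD : forall i a b, e i (a + b) = e i a + e i b.
Hypothesis ee : forall i a b, br 2 (e i a) (e i b) = 0.
Hypothesis serre1 : forall i a b c,
  br 3 (e i a) (br 2 (e i b) (e (s i) c)) = 0.
Hypothesis serre2 : forall i a b c,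
  br 3 (e i a) (br 2 (e i b) (e (s (s i)) c)) = 0.

Lemma br0l p q n y : n = (p + q)%N -> @br p q n 0 y = 0.
Proof. by move=> En; apply: (addrI (@br p q n 0 y)); rewrite -brDl // !addr0. Qed.

Lemma br0r p q n x : n = (p + q)%N -> @br p q n x 0 = 0.
Proof. by move=> En; apply: (addrI (@br p q n x 0)); rewrite -brDr // !addr0. Qed.

Lemma brNl p q n x y : n = (p + q)%N -> @br p q n (- x) y = - br n x y.
Proof.
by move=> En; apply: (addrI (br n x y)); rewrite -brDl // !subrr br0l.
Qed.

Lemma brNr p q n x y : n = (p + q)%N -> @br p q n x (- y) = - br n x y.
Proof.
by move=> En; apply: (addrI (br n x y)); rewrite -brDr // !subrr br0r.
Qed.

Lemma brMnl p q n x y k : n = (p + q)%N -> @br p q n (x *+ k) y = br n x y *+ k.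
Proof.
by move=> En; elim: k => [|k IHk]; rewrite ?mulr0n ?br0l // !mulrS brDl ?IHk.
Qed.

Lemma brMnr p q n x y k : n = (p + q)%N -> @br p q n x (y *+ k) = br n x y *+ k.
Proof.
by move=> En; elim: k => [|k IHk]; rewrite ?mulr0n ?br0r // !mulrS brDr ?IHk.
Qed.

Lemma biadditive_rat_zmod (V : zmodType) (f : rat -> rat -> V) :
  (forall a a' b, f (a + a') b = f a b + f a' b) ->
  (forall a b b', f a (b + b') = f a b + f a b') ->
  forall a b, f a b = f 1 (a * b).
Proof. exact: (@biadditive_rat (Algebra.to_multiplicative V)). Qed.

Lemma biadditive_ratC (V : zmodType) (f : rat -> rat -> V) :
  (forall a a' b, f (a + a') b = f a b + f a' b) ->
  (forall a b b', f a (b + b') = f a b + f a b') ->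
  forall a, f a 1 = f 1 a.
Proof. by move=> fl fr a; rewrite (biadditive_rat_zmod fl fr) mulr1. Qed.

(* The components [gr n] are not known to be torsion free, but a multiple can be
   divided out in a relation between families indexed by rat. *)
Lemma additive_rat_torsion (V : zmodType) (f : rat -> V) k :
  (forall a b, f (a + b) = f a + f b) -> (forall a, f a *+ k.+1 = 0) ->
  forall a, f a = 0.
Proof.
move=> fD fk a.
have fMn n x : f (x *+ n) = f x *+ n.
  elim: n => [|n IHn]; last by rewrite !mulrS fD IHn.
  by rewrite !mulr0n; apply: (addrI (f 0)); rewrite -fD !addr0.
have -> : a = (a / k.+1%:R) *+ k.+1 by rewrite -mulr_natr mulfVK // pnatr_eq0.
by rewrite fMn.
Qed.

(** The operator ad e_i(1). For an additive family x, biadditivity turns [e_i(c), x_j(a)] into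
    [D i (x j (c * a))], so the operators [D i] carry all the information. *)
Definition D i n (x : gr n) : gr n.+1 := br n.+1 (e i 1) x.

Lemma DD i n : {morph @D i n : x y / x + y}.
Proof. by move=> x y; apply: brDr. Qed.
Lemma D0 i n : @D i n 0 = 0.
Proof. exact: br0r. Qed.
Lemma DN i n : {morph @D i n : x / - x}.
Proof. by move=> x; apply: brNr. Qed.
Lemma DMn i n k : {morph @D i n : x / x *+ k}.
Proof. by move=> x; apply: brMnr. Qed.

Lemma ad_D i j n (y : gr n) :
  br n.+2 (D i (e j 1)) y = D i (D j y) - D j (D i y).
Proof. by apply/esym/eqP; rewrite subr_eq; apply/eqP; apply: brJ. Qed.

(** The adjoint action of [e_i, [e_i, e_j]] = 0, expanded by the Jacobi identity. *)
Lemma serre_op i j n (y : gr n) : j = s i \/ j = s (s i) ->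
  D i (D i (D j y)) + D j (D i (D i y)) = D i (D j (D i y)) *+ 2.
Proof.
move=> ij.
have z : br 3 (e i 1) (br 2 (e i 1) (e j 1)) = 0 by case: ij => ->.
have := @brJ 1 2 n 3 n.+1 n.+2 n.+3 (e i 1) (br 2 (e i 1) (e j 1)) y
  erefl erefl erefl erefl.
rewrite z br0l // add0r -/(D i (e j 1)) !ad_D -/(D i _) -/(D i y) DD DN mulr2n => E.
by move/eqP: E; rewrite subr_eq => /eqP ->; rewrite addrAC subrK.
Qed.

(** * One period of three degrees, modelled on sl_3[t] *)

Section Level.
Variables (n : nat) (x : I -> rat -> gr n).
Hypothesis xD : forall i a b, x i (a + b) = x i a + x i b.

(* In sl_3[t], if x i is E_i t^m then [lev_b x i], [lev_h x i], [lev_next x i] are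
   F_i t^(m+1), H_i t^(m+1) and E_i t^(m+1). *)
Definition lev_b i c : gr n.+1 := D (s i) (x (s (s i)) c).
Definition lev_h i c : gr n.+2 := D i (lev_b i c).
Definition lev_next i c : gr n.+3 := D i (lev_h (s i) c).

Lemma lev_bD i a b : lev_b i (a + b) = lev_b i a + lev_b i b.
Proof. by rewrite /lev_b xD DD. Qed.
Lemma lev_hD i a b : lev_h i (a + b) = lev_h i a + lev_h i b.
Proof. by rewrite /lev_h lev_bD DD. Qed.
Lemma lev_nextD i a b : lev_next i (a + b) = lev_next i a + lev_next i b.
Proof. by rewrite /lev_next lev_hD DD. Qed.

Definition rel_ab := forall i c, D (s i) (x i c) = - D i (x (s i) c).
Definition rel_aa := forall i c, D i (x i c) = 0.
Definition rel_bb := forall i c,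
  D i (lev_b (s i) c) = 0 /\ D i (lev_b (s (s i)) c) = 0.
Definition rel_h := forall i c,
  lev_h i c + lev_h (s i) c + lev_h (s (s i)) c = 0.
Definition rel_ha := forall i c,
  D i (lev_h (s (s i)) c) = lev_next i c /\
  D i (lev_h i c) = - (lev_next i c *+ 2).

Hypotheses (Rab : rel_ab) (Raa : rel_aa) (Rbb : rel_bb) (Rh : rel_h).

Lemma D_a_next i c : D i (x (s i) c) = lev_b (s (s i)) c.
Proof. by rewrite /lev_b !s3. Qed.

Lemma D_a_prev i c : D i (x (s (s i)) c) = - lev_b (s i) c.
Proof. by rewrite -[i in D i _]s3 Rab /lev_b s3. Qed.

(** The Serre relation for i and s i, applied to x at s (s i), gives the coefficient -2; applying
    [D i] to [rel_h] then gives the other equality. *)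
Lemma lev_ha : rel_ha.
Proof.
move=> i c.
have hi : D i (lev_h i c) = - (lev_next i c *+ 2).
  have := serre_op (x (s (s i)) c) (or_introl (erefl (s i))).
  rewrite -/(lev_b i c) -/(lev_h i c) D_a_prev !DN.
  by rewrite (Rbb i c).1 D0 oppr0 addr0 => ->; rewrite mulNrn.
split=> //.
have := congr1 (@D i _) (Rh i c); rewrite !DD D0 hi -/(lev_next i c).
by rewrite mulr2n opprD subrK addrC => /eqP; rewrite subr_eq0 => /eqP.
Qed.

End Level.

(** * Passage to the next period *)

Section LevelStep.
Variables (n : nat) (x : I -> rat -> gr n).
Hypothesis xD : forall i a b, x i (a + b) = x i a + x i b.
Hypotheses (Rbb : rel_bb x) (Rha : rel_ha x).
Local Notation y := (lev_next x).

Lemma next_aa : rel_aa y.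
Proof.
move=> i c; rewrite /lev_next {1}/lev_h.
have := serre_op (lev_b x (s i) c) (or_introl (erefl (s i))).
by rewrite (Rbb i c).1 !D0 addr0 mul0rn.
Qed.

Lemma next_ab : rel_ab y.
Proof.
move=> i c; set j := s i.
suff: D j (y i c) + D i (y j c) = 0 by move/eqP; rewrite addr_eq0 => /eqP.
(* The Serre relation on [lev_b x j c] only yields twice the desired relation; the factor 2 is
   divided out. *)
apply: (@additive_rat_torsion _ (fun c => D j (y i c) + D i (y j c)) 1).
  by move=> a b; rewrite !lev_nextD // !DD addrACA.
move=> {}c /=.
have := @serre_op j i _ (lev_b x j c); rewrite /j s3 => /(_ (or_intror erefl)).
rewrite -/j (Rbb i c).1 !D0 add0r -/(lev_h x j c) (Rha j c).2.
rewrite DN DMn => E; rewrite mulrnDl -/(lev_next x j c) in E *.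
by rewrite -E addNr.
Qed.

Lemma next_bb : rel_bb y.
Proof.
move=> i c.
have Raa := next_aa; have Rab := next_ab.
split.
  (* For the element w to be killed, the Serre relation on [lev_h x (s i) c] reads -w = 2w, hence 3w
     = 0. The second half is similar. *)
  apply: (@additive_rat_torsion _ (fun c => D i (lev_b y (s i) c)) 2).
    by move=> a b; rewrite lev_bD ?DD //; apply: lev_nextD.
  move=> {}c /=.
  have := @serre_op i (s (s i)) _ (lev_h x (s i) c) (or_intror erefl).
  rewrite -/(lev_next x i c) Raa D0 addr0.
  have := (Rha (s (s i)) c).1; rewrite !s3 => ->.
  rewrite (D_a_prev Rab) DN.
  have -> : D (s (s i)) (y i c) = lev_b y (s i) c by rewrite /lev_b s3.
  by move/eqP; rewrite eqr_oppLR -addr_eq0 -mulrS => /eqP.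
apply: (@additive_rat_torsion _ (fun c => D i (lev_b y (s (s i)) c)) 2).
  by move=> a b; rewrite lev_bD ?DD //; apply: lev_nextD.
move=> {}c /=.
have := @serre_op i (s i) _ (lev_h x (s (s i)) c) (or_introl erefl).
rewrite (Rha i c).1 Raa D0 addr0 (Rab i c) DN.
rewrite -[D (s i) (lev_h _ _ _)]/(lev_next x (s i) c) (D_a_next y i c).
by rewrite mulNrn => /eqP; rewrite -addr_eq0 -mulrS => /eqP.
Qed.

End LevelStep.

(** * The action of the Cartan elements of degree 3 *)

Section AdCartan.

Definition adh i n (y : gr n) : gr n.+3 := br n.+3 (lev_h e i 1) y.

Lemma adhE i n (y : gr n) :
  adh i y = D i (D (s i) (D (s (s i)) y)) - D i (D (s (s i)) (D (s i) y))
    - (D (s i) (D (s (s i)) (D i y)) - D (s (s i)) (D (s i) (D i y))).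
Proof.
rewrite -(DN i) -DD -!ad_D -/(lev_b e i 1); apply/eqP.
by rewrite -subr_eq opprK; apply/eqP/esym/brJ.
Qed.

Variables (n : nat) (x : I -> rat -> gr n).
Hypotheses (Rab : rel_ab x) (Raa : rel_aa x) (Rbb : rel_bb x) (Rha : rel_ha x).

Lemma D_ss_a i c : D (s (s i)) (x i c) = lev_b x (s i) c.
Proof. by rewrite /lev_b s3. Qed.

Lemma D_s_a i c : D (s i) (x i c) = - lev_b x (s (s i)) c.
Proof. by rewrite Rab D_a_next. Qed.

Lemma D_s_b i c : D (s i) (lev_b x i c) = 0.
Proof. by have := (Rbb (s i) c).2; rewrite s3. Qed.

Lemma D_ss_b i c : D (s (s i)) (lev_b x i c) = 0.
Proof. by have := (Rbb (s (s i)) c).1; rewrite s3. Qed.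

Lemma D_s_h i c : D (s i) (lev_h x i c) = lev_next x (s i) c.
Proof. by have := (Rha (s i) c).1; rewrite s3. Qed.

Lemma D_ss_h i c : D (s (s i)) (lev_h x i c) = lev_next x (s (s i)) c.
Proof. by rewrite /lev_next s3. Qed.

Lemma adh_a i c : adh i (x i c) = lev_next x i c *+ 2.
Proof.
rewrite adhE D_ss_a D_s_a Raa !D0 subrr subr0 !DN opprK.
by rewrite -/(lev_h x (s i) c) -/(lev_h x (s (s i)) c) (Rha i c).1 mulr2n.
Qed.

Lemma adh_b i c : rel_ab (lev_next x) ->
  adh i (lev_b x i c) = - (lev_b (lev_next x) i c *+ 2).
Proof.
move=> Rab'; rewrite adhE D_ss_b D_s_b !D0 subrr add0r -/(lev_h x i c).
rewrite D_ss_h D_s_h -/(lev_b _ _ _); congr (- _).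
by rewrite Rab' opprK mulr2n.
Qed.

(** In sl_3[t] both sides vanish. Here the right side is twice the obstruction to [rel_h] on the
    next level, which makes that obstruction computable. *)
Lemma adh_h i c : rel_ab (lev_next x) ->
  adh i (lev_h x i c) =
  (lev_h (lev_next x) i c + lev_h (lev_next x) (s i) c +
   lev_h (lev_next x) (s (s i)) c) *+ 2.
Proof.
move=> Rab'; rewrite adhE D_s_h D_ss_h (Rha i c).2 !DN !DMn.
have -> : D (s (s i)) (lev_next x (s i) c) = - lev_b (lev_next x) i c.
  exact: Rab'.
have -> : D (s (s i)) (lev_next x i c) = lev_b (lev_next x) (s i) c.
  by rewrite /lev_b s3.
have -> : D (s i) (lev_next x i c) = - lev_b (lev_next x) (s (s i)) c.
  by rewrite (Rab' i) D_a_next.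
rewrite !DN -!/(lev_h (lev_next x) _ _) mulNrn !opprK opprD opprK !mulrnDl.
by rewrite opprK -mulr2n addrA.
Qed.

End AdCartan.

(** Equal to 3m+1, but defined by recursion so that [tower] typechecks by conversion. *)
Fixpoint deg m := if m is m'.+1 then (deg m').+3 else 1%N.

Lemma degE m : deg m = (3 * m).+1.
Proof. by elim: m => //= m ->; lia. Qed.

Fixpoint tower m : I -> rat -> gr (deg m) :=
  if m is m'.+1 then lev_next (tower m') else e.

Lemma towerD m i a b : tower m i (a + b) = tower m i a + tower m i b.
Proof.
by elim: m i a b => [|m IHm] i a b; [apply: eD | apply: lev_nextD].
Qed.

Definition pairing_ab m p q i c : gr (deg m).+2 :=
  br (deg m).+2 (tower p i 1) (lev_b (tower q) i c).

(** The field [rels_pairing] strengthens the induction: it is what yields [rel_h] one level up. *)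
Record level_rels m : Prop := LevelRels {
  rels_ab : rel_ab (tower m);
  rels_aa : rel_aa (tower m);
  rels_bb : rel_bb (tower m);
  rels_h : rel_h (tower m);
  rels_pairing : forall p q, (p + q)%N = m -> forall i c,
    pairing_ab m p q i c = lev_h (tower m) i c
}.

Lemma rels_ha m : level_rels m -> rel_ha (tower m).
Proof. by case=> Rab _ Rbb Rh _; apply: lev_ha. Qed.

Lemma level_rels0 : level_rels 0.
Proof.
have shift p q n (f : rat -> gr p) (g : rat -> gr q) c : n = (p + q)%N ->
    (forall a b, f (a + b) = f a + f b) -> (forall a b, g (a + b) = g a + g b) ->
    br n (f c) (g 1) = br n (f 1) (g c).
  move=> En fD gD; apply: (@biadditive_ratC _ (fun a b => br n (f a) (g b))).
    by move=> a a' b; rewrite fD brDl.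
  by move=> a a' b; rewrite gD brDr.
have Rab : rel_ab e.
  move=> i c; rewrite /D -(@shift _ _ 2 (e i) (e (s i))) //.
  exact: brC.
split=> //.
- by move=> i c; apply: ee.
- move=> i c; split; last first.
    by rewrite /lev_b !s3; apply: serre1.
  by rewrite -[lev_b e (s i) c]opprK -(D_a_prev Rab) DN;
     rewrite [X in - X]serre2 oppr0.
(* For the generators, [rel_h] is the Jacobi identity, once the scalar c has been moved to [e k] in
   all three terms. *)
- move=> i c; rewrite /lev_h /lev_b.
  set j := s i; set k := s j; rewrite /k /j !s3 -/j -/k.
  have -> : D j (D k (e i c)) = br 3 (e j 1) (br 2 (e k c) (e i 1)).
    by congr (br _ _ _); apply/esym/shift.
  have -> : D k (D i (e j c)) = br 3 (e k c) (br 2 (e i 1) (e j 1)).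
    rewrite /D -(@shift _ _ 2 (e i) (e j)) //.
    apply/esym/(@shift _ _ 3 (e k) (fun c => br 2 (e i c) (e j 1))) => //.
    by move=> a b; rewrite eD brDl.
  have -> : D i (D j (e k c)) =
      br 3 (br 2 (e i 1) (e j 1)) (e k c) + br 3 (e j 1) (br 2 (e i 1) (e k c)).
    exact: brJ.
  rewrite [br 2 (e k c) _]brC // brNr // [br 3 (e k c) _]brC //.
  by rewrite addrK subrr.
- by case=> [|p] [|q].
Qed.

(* Only [rel_h] is not a consequence of the Serre relations applied to the
   previous level. Acting by [lev_h e i 1] on [x_i t^p, y_i t^q] with p + q = m
   shows that [x_i t^p, y_i t^(m+1-p)] depends on p as h_i + p z, where z is the
   sum of the three h_i; comparing p = 0 with p = m + 1 gives (m + 2) z = 0. *)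
Lemma level_relsS m : (forall m', (m' <= m)%N -> level_rels m') ->
  level_rels m.+1.
Proof.
move=> IH; have Hm := IH m (leqnn m); have Rha := rels_ha Hm.
have xD := @towerD m.
have Rab' : rel_ab (tower m.+1) by exact: (next_ab xD (rels_bb Hm) Rha).
have Raa' : rel_aa (tower m.+1) by exact: (next_aa (rels_bb Hm)).
have Rbb' : rel_bb (tower m.+1) by exact: (next_bb xD (rels_bb Hm) Rha).
pose z i c := lev_h (tower m.+1) i c + lev_h (tower m.+1) (s i) c +
  lev_h (tower m.+1) (s (s i)) c.
have hD := lev_hD (@towerD m.+1).
have zD i a b : z i (a + b) = z i a + z i b.
  by rewrite /z !hD (addrACA (lev_h _ i a)) [LHS]addrACA.
have pD p q : (p + q)%N = m.+1 -> forall i a b,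
    pairing_ab m.+1 p q i (a + b) = pairing_ab m.+1 p q i a + pairing_ab m.+1 p q i b.
  move=> pq i a b; rewrite /pairing_ab lev_bD; last exact: towerD.
  by rewrite brDr // -pq !degE; lia.
have step p q : (p + q)%N = m -> forall i c,
    pairing_ab m.+1 p.+1 q i c = pairing_ab m.+1 p q.+1 i c + z i c.
  move=> pq i c; apply/eqP; rewrite -subr_eq0; apply/eqP; move: c.
  apply: (@additive_rat_torsion _ (fun c => pairing_ab m.+1 p.+1 q i c -
    (pairing_ab m.+1 p q.+1 i c + z i c)) 1) => [a b|c].
    rewrite !pD ?zD ?addSn ?addnS ?pq // [X in _ - X]addrACA opprD.
    by rewrite addrACA.
  have [Hp Hq] : level_rels p /\ level_rels q.
    by split; apply: IH; rewrite -pq ?leq_addr ?leq_addl.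
  have Rab'q : rel_ab (tower q.+1).
    exact: (next_ab (@towerD q) (rels_bb Hq) (rels_ha Hq)).
  (* As a derivation, [adh i] multiplies the two factors by 2 and -2 while raising p or q by one, so
     2z is twice the difference of the two pairings. *)
  have := adh_h (rels_ha Hm) i c Rab'.
  rewrite -/(z i c) -(rels_pairing Hm pq) /adh /pairing_ab.
  rewrite (@brJ _ _ _ (deg p).+3 (deg q).+4) ?degE; [|lia..].
  rewrite -/(adh i (tower p i 1)) -/(adh i (lev_b (tower q) i c)).
  rewrite (adh_a (rels_ab Hp) (rels_aa Hp) (rels_ha Hp)).
  rewrite (adh_b (rels_bb Hq) (rels_ha Hq) _ _ Rab'q).
  rewrite brMnl ?brNr ?brMnr; [|rewrite -pq ?degE; lia..].
  move=> E; rewrite opprD addrA mulrnBl -E mulrnBl; exact: subrr.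
have pE p q : (p + q)%N = m.+1 -> forall i c,
    pairing_ab m.+1 p q i c = lev_h (tower m.+1) i c + z i c *+ p.
  elim: p q => [|p IHp] q pq i c; first by rewrite add0n in pq; rewrite pq addr0.
  by rewrite step ?(IHp q.+1) -?addrA ?mulrSr // -?addSnnS // -?pq; lia.
have z0 i c : z i c = 0.
  move: c; apply: (@additive_rat_torsion _ _ m.+1) => // c.
  (* For q = 0 the second factor is a bracket of two generators, so by Jacobi the pairing also
     equals minus the sum of the h at s i and s (s i). *)
  have := pE m.+1 0%N (addn0 _) i c; rewrite /pairing_ab.
  have E2 : (deg m.+1).+2 = (deg m.+1 + (deg 0).+1)%N by rewrite addn2.
  rewrite -(@biadditive_ratC _ (fun a b =>
    br (deg m.+1).+2 (tower m.+1 i a) (lev_b (tower 0) i b))); first last.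
  - by move=> a b b'; rewrite (lev_bD eD) brDr.
  - by move=> a a' b; rewrite towerD brDl.
  rewrite brC // ad_D (D_ss_a (tower m.+1)) (D_s_a Rab') DN opprK.
  rewrite -!/(lev_h (tower m.+1) _ _) => /eqP; rewrite eq_sym -addr_eq0.
  rewrite addrAC addrA => E; apply/eqP; move: E; congr (_ == 0).
split=> //.
by move=> p q pq i c; rewrite pE // z0 mul0rn addr0.
Qed.

Theorem tower_rels m : level_rels m.
Proof.
elim/ltn_ind: m => -[|m] IHm; first exact: level_rels0.
by apply: level_relsS.
Qed.

(** * Spanning families in each degree *)

Section Spanning.
Hypothesis Icase : forall i j, [\/ j = i, j = s i | j = s (s i)].
Hypothesis s_neq : forall i, (s i == i) = false.
Variable o : I.

Definition span3 n (x : I -> rat -> gr n) (y : gr n) :=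
  exists f : I -> rat, y = x o (f o) + x (s o) (f (s o)) + x (s (s o)) (f (s (s o))).

Hypothesis gr1_gen : forall y, span3 e y.
Hypothesis gr_gen : forall n, (0 < n)%N -> forall P : gr n.+1 -> Prop,
  P 0 -> (forall x y, P x -> P y -> P (x + y)) -> (forall x, P x -> P (- x)) ->
  (forall i c (y : gr n), P (br n.+1 (e i c) y)) -> forall x, P x.

Section Span.
Variables (n : nat) (x : I -> rat -> gr n).
Hypothesis xD : forall i a b, x i (a + b) = x i a + x i b.

Lemma family0 i : x i 0 = 0.
Proof. by apply: (addrI (x i 0)); rewrite -xD !addr0. Qed.

Lemma span3_0 : span3 x 0.
Proof. by exists (fun=> 0); rewrite !family0 !addr0. Qed.

Lemma span3D y z : span3 x y -> span3 x z -> span3 x (y + z).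
Proof.
move=> [f ->] [g ->]; exists (fun i => f i + g i); rewrite !xD.
by rewrite addrACA (addrACA (x o _)).
Qed.

Lemma span3N y : span3 x y -> span3 x (- y).
Proof.
move=> [f ->]; exists (fun i => - f i).
have xN i a : x i (- a) = - x i a.
  by apply: (addrI (x i a)); rewrite -xD !subrr family0.
by rewrite !xN !opprD.
Qed.

Lemma span3_mem i c : span3 x (x i c).
Proof.
have ss_neq j : (s (s j) == j) = false.
  by apply/eqP=> E; have := s3 j; rewrite E => /eqP; rewrite s_neq.
exists (fun j => if j == i then c else 0).
have [E1 E2] : ((o == s o) = false) /\ ((o == s (s o)) = false).
  by rewrite eq_sym s_neq eq_sym ss_neq.
have E3 : (s o == s (s o)) = false by rewrite eq_sym s_neq.
by case: (Icase o i) => ->; rewrite ?eqxx ?E1 ?E2 ?E3 ?s_neq ?ss_neq ?s_neq !family0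
  ?addr0 ?add0r.
Qed.

End Span.

(** Degree n.+1 is additively generated by the brackets [e_i(c), x_j(a)], each equal to
    [D i (x j (c * a))]; the last three hypotheses before the spanning one run over the position of
    j relative to i. *)
Lemma span3_step n (x : I -> rat -> gr n) (x' : I -> rat -> gr n.+1) :
    (0 < n)%N ->
    (forall i a b, x i (a + b) = x i a + x i b) ->
    (forall i a b, x' i (a + b) = x' i a + x' i b) ->
    (forall i c, span3 x' (D i (x i c))) ->
    (forall i c, span3 x' (D i (x (s i) c))) ->
    (forall i c, span3 x' (D i (x (s (s i)) c))) ->
  (forall y, span3 x y) -> forall y, span3 x' y.
Proof.
move=> n0 xD x'D s0 s1 s2 sx; apply: gr_gen => //; first exact: span3_0.
- by move=> y z; apply: span3D.
- by move=> y; apply: span3N.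
move=> i c y; have [f ->] := sx y; rewrite !brDr //.
have bi j a : br n.+1 (e i c) (x j a) = D i (x j (c * a)).
  apply: (@biadditive_rat_zmod _ (fun c a => br n.+1 (e i c) (x j a))).
    by move=> *; rewrite eD brDl.
  by move=> *; rewrite xD brDr.
have sD j a : span3 x' (D i (x j a)) by case: (Icase i j) => ->.
by rewrite !bi; apply: span3D => //; apply: span3D.
Qed.

Theorem tower_span m :
  [/\ forall y, span3 (tower m) y, forall y, span3 (lev_b (tower m)) y
    & forall y, span3 (lev_h (tower m)) y].
Proof.
have from_a k : (forall y, span3 (tower k) y) ->
    (forall y, span3 (lev_b (tower k)) y) /\ (forall y, span3 (lev_h (tower k)) y).
  move=> sa; have R := tower_rels k.
  have aD := @towerD k; have bD := lev_bD aD; have hD := lev_hD aD.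
  have sb y : span3 (lev_b (tower k)) y.
    apply: (span3_step _ aD bD _ _ _ sa) => [|i c|i c|i c]; first by rewrite degE.
    - by rewrite (rels_aa R); apply: span3_0.
    - by rewrite D_a_next; apply: span3_mem.
    - by rewrite (D_a_prev (rels_ab R)); apply: span3N => //; apply: span3_mem.
  split=> //; apply: (span3_step _ bD hD _ _ _ sb) => // i c.
  - exact: span3_mem.
  - by rewrite (rels_bb R i c).1; apply: span3_0.
  - by rewrite (rels_bb R i c).2; apply: span3_0.
suff sa : forall y, span3 (tower m) y by split=> //; case: (from_a m sa).
elim: m => [|m IHm]; first exact: gr1_gen.
have [_ sh] := from_a m IHm.
have aD := @towerD m; have hD := lev_hD aD; have nD := lev_nextD aD.
have Rha := rels_ha (tower_rels m).
apply: (span3_step _ hD nD _ _ _ sh) => // i c.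
- rewrite (Rha i c).2 mulr2n opprD.
  by apply: span3D => //; apply: span3N => //; apply: span3_mem.
- exact: span3_mem.
- by rewrite (Rha i c).1; apply: span3_mem.
Qed.

End Spanning.

End AffineNilpotent.

(** * The graded Lie ring of the lower central series *)

Section LowerCentralSeries.
Local Open Scope classical_set_scope.
Local Open Scope group_scope.
Variable G : groupType.
Implicit Types x y z : G.

Lemma generated_subgroup (S : set G) : is_subgroup (generated S).
Proof.
split=> [A [[]//]|x y Sx Sy A HA].
by apply: HA.1.2; [apply: Sx | apply: Sy].
Qed.

Lemma sub_generated (S : set G) : S `<=` generated S.
Proof. by move=> x Sx A [_]; apply. Qed.

Lemma commMgJ x y z : [~ x * y, z] = [~ x, z] ^ y * [~ y, z].
Proof. by rewrite !commgEr conjgM mulgA -conjMg mulgK. Qed.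

Lemma commgMJ x y z : [~ x, y * z] = [~ x, z] * [~ x, y] ^ z.
Proof. by rewrite !commgEl conjgM -mulgA -conjMg mulVKg. Qed.

Lemma Hall_Witt_identity x y z :
  [~ [~ x, y^-1], z] ^ y * [~ [~ y, z^-1], x] ^ z * [~ [~ z, x^-1], y] ^ x = 1.
Proof.
rewrite /commg /conjg !(invgM, invgK) -!mulgA.
by rewrite !(mulKg, mulVKg, mulVg, mulgV, mulg1).
Qed.

Lemma commVg_conj x y : [~ x^-1, y] = ([~ x, y] ^ x^-1)^-1.
Proof.
apply: (mulgI ([~ x, y] ^ x^-1)).
by rewrite mulgV -commMgJ mulgV comm1g.
Qed.

Lemma lcs_normal n : is_normal_subgroup (lcs G n).
Proof.
have nT : is_normal_subgroup [set: G] by [].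
elim: n => [//|[//|n] [sN nN]].
split; first exact: generated_subgroup.
move=> x y Lx; have : generated [set [~ u, v] | u in setT & v in lcs G n.+1] `<=`
    [set x | forall y, lcs G n.+2 (x ^ y)].
  apply: generated_sub.
    split=> [z|u v Lu Lv z]; first by rewrite conj1g; exact: (generated_subgroup _).1.
    rewrite conjMg conjVg.
    by apply: (generated_subgroup _).2; [exact: Lu | exact: Lv].
  move=> _ [u _ [v Lv <-]] z; rewrite conjRg; apply: sub_generated.
  by exists (u ^ z) => //; exists (v ^ z) => //; apply: nN.
exact.
Qed.

Lemma lcs_subgroup n : is_subgroup (lcs G n).
Proof. exact: (lcs_normal n).1. Qed.
Lemma lcs1 n : lcs G n 1.
Proof. exact: (lcs_subgroup n).1. Qed.
Lemma lcsM n x y : lcs G n x -> lcs G n y -> lcs G n (x * y).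
Proof. exact: (subgroupM (lcs_subgroup n)). Qed.
Lemma lcsV n x : lcs G n x -> lcs G n x^-1.
Proof. exact: (subgroupV (lcs_subgroup n)). Qed.
Lemma lcsJ n x y : lcs G n x -> lcs G n (x ^ y).
Proof. exact: (lcs_normal n).2. Qed.

Lemma lcs_commS n x y : lcs G n y -> lcs G n.+1 [~ x, y].
Proof. by case: n => // n Ly; apply: sub_generated; exists x => //; exists y. Qed.

Lemma lcs_commC n x y : lcs G n [~ x, y] -> lcs G n [~ y, x].
Proof. by move/lcsV; rewrite invgR. Qed.

Lemma lcsS n x : lcs G n.+1 x -> lcs G n x.
Proof.
case: n => // n; move: x; apply: generated_sub; first exact: lcs_subgroup.
move=> _ [x _ [y Ly <-]]; rewrite commgEr.
by apply: lcsM => //; apply/lcsJ/lcsV.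
Qed.

(** The three subgroups argument: the Hall-Witt identity reduces [[g, u], y] to commutators covered
    by the induction hypothesis for u. The case p = 0 only concerns the dummy [lcs 0]. *)
Lemma lcs_comm p q x y : lcs G p x -> lcs G q y -> lcs G (p + q) [~ x, y].
Proof.
elim: p q x y => [|[|p] IHp] q x y Lx Ly.
- by rewrite add0n; apply/lcsS/lcs_commS.
- exact: lcs_commS.
move: x Lx; apply: generated_sub.
  split=> [|u v Lu Lv]; first by change (lcs G (p.+2 + q) [~ 1, y]); rewrite comm1g; apply: lcs1.
  change (lcs G (p.+2 + q) [~ u / v, y]); rewrite commMgJ commVg_conj.
  by apply: lcsM; [apply: lcsJ | apply/lcsV/lcsJ].
move=> _ [g _ [u Lu <-]]; change (lcs G (p.+2 + q) [~ [~ g, u], y]).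
have := Hall_Witt_identity g u^-1 y; rewrite invgK -mulgA => /mulg1_eq E.
rewrite -[X in lcs _ _ X](conjgK u^-1) -[X in X ^ _]invgK.
apply/lcsJ/lcsV; rewrite E; apply: lcsM; apply: lcsJ.
  by apply/lcs_commC/lcs_commS/IHp; exact: lcsV.
rewrite addSnnS; apply/lcs_commC/IHp; first exact: lcsV.
by apply/lcs_commC/lcs_commS.
Qed.

End LowerCentralSeries.

(** * The factors of the lower central series and their bracket *)

Section GradedRing.
Local Open Scope group_scope.
Variable G : groupType.
Implicit Types (n p q r : nat) (g h k : G).

Definition lcs_normalSubgroup n := NormalSubgroup (lcs_normal G n).

Local Notation coset n := (quotient_map (lcs_normalSubgroup n.+1)).

(** The factor gamma_n / gamma_(n+1), realized inside G / gamma_(n+1) as the cosets that meet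
    gamma_n; this avoids turning gamma_n into a group type. *)
Record lcs_factor n := LcsFactor {
  lcs_factor_val : quotient_group (lcs_normalSubgroup n.+1);
  _ : `[< exists2 g, lcs G n g & coset n g = lcs_factor_val >]
}.

HB.instance Definition _ n := [isSub for @lcs_factor_val n].
HB.instance Definition _ n := [Choice of lcs_factor n by <:].

Lemma lcs_factor_subproof n g : lcs G n g ->
  `[< exists2 h, lcs G n h & coset n h = coset n g >].
Proof. by move=> Lg; apply/asboolP; exists g. Qed.

Definition lcs_cls0 n := LcsFactor (lcs_factor_subproof (lcs1 G n)).

(** Total in g: outside gamma_n the value defaults to the class of 1. *)
Definition lcs_cls n g : lcs_factor n := insubd (lcs_cls0 n) (coset n g).

Lemma lcs_clsP n (x : lcs_factor n) : {g | lcs G n g & x = lcs_cls n g}.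
Proof.
apply: cid2; case: x => u ux; have [g Lg gu] := asboolP _ ux.
by exists g => //; apply: val_inj; rewrite /lcs_cls gu insubdK.
Qed.

Lemma val_lcs_cls n g : lcs G n g -> val (lcs_cls n g) = coset n g.
Proof. by move=> Lg; rewrite /lcs_cls insubdK //; apply: lcs_factor_subproof. Qed.

Lemma lcs_cls_eq n g h : lcs G n g -> lcs G n h ->
  lcs_cls n g = lcs_cls n h <-> lcs G n.+1 (g^-1 * h).
Proof.
move=> Lg Lh; have := quotient_map_eq (lcs_normalSubgroup n.+1) g h.
rewrite -!val_lcs_cls // => -[E1 E2].
by split=> [Egh|/E2 /val_inj //]; apply: E1; rewrite Egh.
Qed.

Definition lcs_rep n (x : lcs_factor n) := s2val (lcs_clsP x).
Lemma lcs_repP n (x : lcs_factor n) : lcs G n (lcs_rep x).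
Proof. exact: s2valP (lcs_clsP x). Qed.
Lemma lcs_repK n (x : lcs_factor n) : lcs_cls n (lcs_rep x) = x.
Proof. exact/esym/(s2valP' (lcs_clsP x)). Qed.

Ltac lcs_side := by do ?[assumption | exact: lcs1 | exact: lcs_repP
  | apply: lcs_comm | apply: lcsJ | apply: lcsV | apply: lcsM].

Definition lcs_add n (x y : lcs_factor n) := lcs_cls n (lcs_rep x * lcs_rep y).
Definition lcs_opp n (x : lcs_factor n) := lcs_cls n (lcs_rep x)^-1.

Lemma lcs_cls_add n g h : lcs G n g -> lcs G n h ->
  lcs_add (lcs_cls n g) (lcs_cls n h) = lcs_cls n (g * h).
Proof.
move=> Lg Lh; apply: val_inj.
have Lr x := @lcs_repP n x; rewrite /lcs_add.
rewrite (val_lcs_cls (lcsM (Lr _) (Lr _))) (val_lcs_cls (lcsM Lg Lh)).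
rewrite !quotient_mapM.
by rewrite -!val_lcs_cls ?lcs_repP // !lcs_repK.
Qed.

Lemma lcs_cls_opp n g : lcs G n g -> lcs_opp (lcs_cls n g) = lcs_cls n g^-1.
Proof.
move=> Lg; apply: val_inj; rewrite /lcs_opp.
rewrite (val_lcs_cls (lcsV (lcs_repP _))) (val_lcs_cls (lcsV Lg)) !quotient_mapV.
by rewrite -val_lcs_cls ?lcs_repK ?val_lcs_cls //; apply: lcs_repP.
Qed.

Lemma lcs_addA n : associative (@lcs_add n).
Proof.
move=> x y z; case: (lcs_clsP x) (lcs_clsP y) (lcs_clsP z).
move=> g Lg -> [h Lh ->] [k Lk ->].
by rewrite !lcs_cls_add ?mulgA; [|lcs_side..].
Qed.

Lemma lcs_addC n : commutative (@lcs_add n).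
Proof.
move=> x y; case: (lcs_clsP x) (lcs_clsP y) => g Lg -> [h Lh ->].
rewrite !lcs_cls_add //; apply/lcs_cls_eq; [lcs_side..|].
by rewrite invgM -mulgA; apply: lcs_commS; lcs_side.
Qed.

Lemma lcs_add0 n : left_id (lcs_cls n 1) (@lcs_add n).
Proof.
move=> x; case: (lcs_clsP x) => g Lg ->.
by rewrite lcs_cls_add ?mul1g; [|lcs_side..].
Qed.

Lemma lcs_addN n : left_inverse (lcs_cls n 1) (@lcs_opp n) (@lcs_add n).
Proof.
move=> x; case: (lcs_clsP x) => g Lg ->.
by rewrite lcs_cls_opp ?lcs_cls_add ?mulVg; [|lcs_side..].
Qed.

HB.instance Definition _ n := GRing.isZmodule.Build (lcs_factor n)
  (@lcs_addA n) (@lcs_addC n) (@lcs_add0 n) (@lcs_addN n).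

Lemma lcs_clsM n g h : lcs G n g -> lcs G n h ->
  lcs_cls n (g * h) = (lcs_cls n g + lcs_cls n h)%R.
Proof. by move=> Lg Lh; rewrite -lcs_cls_add. Qed.

Lemma lcs_clsV n g : lcs G n g -> lcs_cls n g^-1 = (- lcs_cls n g)%R.
Proof. by move=> Lg; rewrite -lcs_cls_opp. Qed.

Lemma lcs_cls_eq0 n g : lcs G n g -> lcs_cls n g = 0%R <-> lcs G n.+1 g.
Proof.
move=> Lg; have := lcs_cls_eq Lg (lcs1 G n); rewrite mulg1 => -[E1 E2].
by split=> [/E1/lcsV|/lcsV/E2//]; rewrite invgK.
Qed.

Lemma lcs_clsJ n g h : lcs G n g -> lcs_cls n (g ^ h) = lcs_cls n g.
Proof.
move=> Lg; apply/esym/lcs_cls_eq; [lcs_side..|]; rewrite -commgEl.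
exact/lcs_commC/lcs_commS.
Qed.

Definition lcs_bracket p q n (x : lcs_factor p) (y : lcs_factor q) :
  lcs_factor n := lcs_cls n [~ lcs_rep x, lcs_rep y].

(** Changing g by an element of gamma_(p+1), or h by one of gamma_(q+1), changes the commutator only
    modulo gamma_(p+q+1). *)
Lemma lcs_clsR p q n g h : n = (p + q)%N -> lcs G p g -> lcs G q h ->
  lcs_bracket n (lcs_cls p g) (lcs_cls q h) = lcs_cls n [~ g, h].
Proof.
move=> -> Lg Lh; rewrite /lcs_bracket.
set g' := lcs_rep _; set h' := lcs_rep _.
have Lg' : lcs G p g' by apply: lcs_repP.
have Lh' : lcs G q h' by apply: lcs_repP.
have Dg : lcs G p.+1 (g^-1 * g') by apply/lcs_cls_eq; rewrite ?lcs_repK.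
have Dh : lcs G q.+1 (h^-1 * h') by apply/lcs_cls_eq; rewrite ?lcs_repK.
rewrite -(mulVKg g g') -(mulVKg h h').
set a := _ * g' in Dg *; set b := _ * h' in Dh *.
have La := lcsS Dg; have Lb := lcsS Dh.
rewrite commMgJ lcs_clsM; [|lcs_side..].
have -> : lcs_cls (p + q) [~ a, h * b] = 0%R.
  by apply/lcs_cls_eq0; [|rewrite -addSn]; lcs_side.
rewrite addr0 commgMJ conjMg lcs_clsM; [|lcs_side..].
rewrite !lcs_clsJ; [|lcs_side..].
have -> : lcs_cls (p + q) [~ g, b] = 0%R.
  by apply/lcs_cls_eq0; [|rewrite -addnS]; lcs_side.
by rewrite add0r.
Qed.

Lemma lcs_bracketDl p q n (x x' : lcs_factor p) (y : lcs_factor q) :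
  n = (p + q)%N ->
  lcs_bracket n (x + x')%R y = (lcs_bracket n x y + lcs_bracket n x' y)%R.
Proof.
case: (lcs_clsP x) (lcs_clsP x') (lcs_clsP y) => g Lg -> [h Lh ->] [k Lk ->] En.
rewrite -lcs_clsM ?lcs_clsR //; last by lcs_side.
by rewrite En commMgJ lcs_clsM ?lcs_clsJ; [|lcs_side..].
Qed.

Lemma lcs_bracketC p q n (x : lcs_factor p) (y : lcs_factor q) :
  n = (p + q)%N -> lcs_bracket n x y = (- lcs_bracket n y x)%R.
Proof.
case: (lcs_clsP x) (lcs_clsP y) => g Lg -> [h Lh ->] En.
rewrite !lcs_clsR // 1?addnC // -lcs_clsV ?invgR // En addnC.
exact: lcs_comm.
Qed.

Lemma lcs_bracketDr p q n (x : lcs_factor p) (y y' : lcs_factor q) :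
  n = (p + q)%N ->
  lcs_bracket n x (y + y')%R = (lcs_bracket n x y + lcs_bracket n x y')%R.
Proof.
move=> En; rewrite !(@lcs_bracketC p q) // lcs_bracketDl 1?addnC //.
by rewrite opprD.
Qed.

(** The class of the Hall-Witt identity: in a factor, conjugation is trivial and inverses become
    signs. *)
Lemma lcs_bracketJ p q r pq pr qr n
    (x : lcs_factor p) (y : lcs_factor q) (z : lcs_factor r) :
  pq = (p + q)%N -> pr = (p + r)%N -> qr = (q + r)%N -> n = (p + q + r)%N ->
  lcs_bracket n x (lcs_bracket qr y z) =
  (lcs_bracket n (lcs_bracket pq x y) z + lcs_bracket n y (lcs_bracket pr x z))%R.
Proof.
case: (lcs_clsP x) (lcs_clsP y) (lcs_clsP z) => g Lg -> [h Lh ->] [k Lk ->].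
move=> -> -> -> ->.
have Lgh : lcs G (p + q) [~ g, h^-1] by lcs_side.
have Lhk : lcs G (q + r) [~ h, k^-1] by lcs_side.
have Lkg : lcs G (p + r) [~ k, g^-1] by rewrite addnC; lcs_side.
have L1 : lcs G (p + q + r) [~ [~ g, h^-1], k] by lcs_side.
have L2 : lcs G (p + q + r) [~ [~ h, k^-1], g] by rewrite -addnA addnC; lcs_side.
have L3 : lcs G (p + q + r) [~ [~ k, g^-1], h] by rewrite addnAC; lcs_side.
have := congr1 (lcs_cls (p + q + r)) (Hall_Witt_identity g h k).
have [J1 J2 J3] := And3 (@lcsJ G _ _ h L1) (@lcsJ G _ _ k L2) (@lcsJ G _ _ g L3).
rewrite (lcs_clsM (lcsM J1 J2) J3) (lcs_clsM J1 J2) {J1 J2 J3}.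
rewrite (lcs_clsJ h L1) (lcs_clsJ k L2) (lcs_clsJ g L3).
set n0 := (p + q + r)%N in L1 L2 L3 *.
set x0 := lcs_cls p g; set y0 := lcs_cls q h; set z0 := lcs_cls r k.
have n12 : n0 = (q + r + p)%N by rewrite /n0 -addnA addnC.
have n13 : n0 = (p + r + q)%N by rewrite /n0 addnAC.
have En : n0 = (p + (q + r))%N by rewrite /n0 addnA.
have Em : n0 = (q + (p + r))%N by rewrite n13 addnC.
have NN := brNr (@lcs_bracketDr); have NL := brNl (@lcs_bracketDl).
have -> : lcs_cls n0 [~ [~ g, h^-1], k] =
    (- lcs_bracket n0 (lcs_bracket (p + q) x0 y0) z0)%R.
  rewrite -(@lcs_clsR (p + q) r) // -(@lcs_clsR p q) //; last exact: lcsV.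
  by rewrite lcs_clsV // NN // NL.
have -> : lcs_cls n0 [~ [~ h, k^-1], g] =
    lcs_bracket n0 x0 (lcs_bracket (q + r) y0 z0).
  rewrite -(@lcs_clsR (q + r) p) // -(@lcs_clsR q r) //; last exact: lcsV.
  by rewrite lcs_clsV // NN // NL // -lcs_bracketC.
have -> : lcs_cls n0 [~ [~ k, g^-1], h] =
    (- lcs_bracket n0 y0 (lcs_bracket (p + r) x0 z0))%R.
  have E : lcs_bracket (p + r) z0 (- x0)%R = lcs_bracket (p + r) x0 z0.
    by rewrite NN 1?addnC // -lcs_bracketC // addnC.
  rewrite -(lcs_bracketC _ _ n13) -E -lcs_clsV // (lcs_clsR (addnC p r) Lk (lcsV Lg)).
  by rewrite lcs_clsR.
have -> : lcs_cls n0 1 = 0%R by [].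
rewrite addrAC -opprD addrC => /eqP; rewrite subr_eq0 => /eqP ->.
by [].
Qed.

Lemma lcs_factor_ind n (P : lcs_factor n.+1 -> Prop) : (0 < n)%N ->
    P 0%R -> (forall x y, P x -> P y -> P (x + y)%R) ->
    (forall x, P x -> P (- x)%R) ->
    (forall (x : lcs_factor 1) (y : lcs_factor n), P (lcs_bracket n.+1 x y)) ->
  forall x, P x.
Proof.
case: n P => // n P _ P0 PD PN PR x; case: (lcs_clsP x) => g Lg ->.
suff [] : lcs G n.+2 g /\ P (lcs_cls n.+2 g) by [].
move: g Lg; apply: generated_sub.
  split; first by split; [apply: lcs1|].
  move=> g h [Lg Pg] [Lh Ph]; split; first by apply: lcsM => //; apply: lcsV.
  by rewrite lcs_clsM ?lcs_clsV //; [apply: PD => //; apply: PN|apply: lcsV].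
move=> _ [g _ [h Lh <-]]; split; first exact: lcs_commS.
by rewrite -(@lcs_clsR 1 n.+1).
Qed.

End GradedRing.

(** * Relations and induction in the presented group *)

Section Presentation.
Local Open Scope group_scope.

Lemma xgenD i (a b : rat) : xgen i (a + b)%R = xgen i a * xgen i b.
Proof.
pose inj := fp_inj (fun _ : 'I_3 => Qadd) i.
transitivity (quotient_map (normal_closure_group U_relators) (inj a * inj b)).
  by congr (quotient_map _ _); apply: (@fp_injM _ (fun=> Qadd) i a b).
exact: quotient_mapM.
Qed.

Lemma xgen0 i : xgen i (0 : rat)%R = 1.
Proof. by apply: (mulgI (xgen i (0 : rat)%R)); rewrite -xgenD addr0 mulg1. Qed.

Lemma xgenN i (a : rat) : xgen i (- a)%R = (xgen i a)^-1.
Proof. by apply/esym/mulg1_eq; rewrite -xgenD subrr xgen0. Qed.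

Lemma xgen_rel i j (a b c : rat) : i != j ->
  [~ xgen i a, [~ xgen i b, xgen j c]] = 1.
Proof.
move=> ij; rewrite /xgen; pose inj i := fp_inj (fun _ : 'I_3 => Qadd) i.
have qR u v : [~ quotient_map (normal_closure_group U_relators) u,
    quotient_map (normal_closure_group U_relators) v] =
    quotient_map (normal_closure_group U_relators) [~ u, v].
  by rewrite gmulfR.
rewrite (qR (inj i b) (inj j c)) (qR (inj i a)).
transitivity (quotient_map (normal_closure_group U_relators) 1).
  2: by rewrite gmulf1.
apply/esym/quotient_map_eq; rewrite invg1 mul1g => A [nA]; apply.
exists (i, j) => //=; apply: sub_generated.
exists (fp_inj (fun=> Qadd) i a); first by exists a.
exists [~ fp_inj (fun=> Qadd) i b, fp_inj (fun=> Qadd) j c] => //.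
apply: sub_generated.
exists (fp_inj (fun=> Qadd) i b); first by exists b.
by exists (fp_inj (fun=> Qadd) j c) => //; exists c.
Qed.

Lemma U_A2t_ind (P : U_A2t -> Prop) :
  P 1 -> (forall i a g, P g -> P (xgen i a * g)) -> forall g, P g.
Proof.
move=> P1 PM x; rewrite -[x]quotient_mapK -[repr x]fp_wordK.
elim: (repr (repr x)) => [//|[i a] w IHw].
have -> : fp_word (@letter _ (fun _ : 'I_3 => Qadd) i a :: w) =
    (fp_inj (fun _ : 'I_3 => Qadd) i a : U_copies) * fp_word w.
  exact: (@fp_wordM _ (fun _ : 'I_3 => Qadd) [:: letter a] w).
by rewrite gmulfM; apply: PM.
Qed.

End Presentation.

(** * The graded Lie ring of [U_A2t] *)

Section NilpotentQuotients.
Local Open Scope ring_scope.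

Definition ord3S (i : 'I_3) : 'I_3 := ordS i.
Local Notation s := ord3S.

Lemma ord3S3 i : s (s (s i)) = i.
Proof. by apply: val_inj; case: i => -[|[|[|]]]. Qed.

Lemma ord3S_neq i : (s i == i) = false.
Proof. by case: i => -[|[|[|]]]. Qed.

Lemma ord3S_case (i j : 'I_3) : [\/ j = i, j = s i | j = s (s i)].
Proof.
by case: i j => -[|[|[|//]]] ? [[|[|[|//]]] ?];
  first [exact/Or31/val_inj | exact/Or32/val_inj | exact/Or33/val_inj].
Qed.

Definition U_e (i : 'I_3) (a : rat) : lcs_factor U_A2t 1 := lcs_cls 1 (xgen i a).

Let e := U_e.
Local Notation br := (@lcs_bracket U_A2t).

Lemma U_eD i a b : e i (a + b) = e i a + e i b.
Proof. by rewrite /e /U_e xgenD lcs_clsM. Qed.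

Lemma U_e_bracket_same i a b : br 2 (e i a) (e i b) = 0.
Proof.
rewrite lcs_clsR //; have -> : [~ xgen i a, xgen i b]%g = 1%g; last by [].
by apply/eqP/commgP; rewrite /commute -!xgenD addrC.
Qed.

Lemma U_serre i j a b c : (i == j) = false ->
  br 3 (e i a) (br 2 (e i b) (e j c)) = 0.
Proof.
move=> ij; rewrite (@lcs_clsR _ 1 1) // (@lcs_clsR _ 1 2) //.
  by rewrite xgen_rel // ij.
exact: (@lcs_commS _ 1).
Qed.

Let serre1 i a b c : br 3 (e i a) (br 2 (e i b) (e (s i) c)) = 0.
Proof. by apply: U_serre; rewrite eq_sym ord3S_neq. Qed.

Let serre2 i a b c : br 3 (e i a) (br 2 (e i b) (e (s (s i)) c)) = 0.
Proof. by apply: U_serre; rewrite -{1}[i]ord3S3 ord3S_neq. Qed.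

Definition U_tower m := tower br s e m.

Lemma U_tower_rels m : level_rels br s e m.
Proof.
apply: tower_rels.
- exact: lcs_bracketDl.
- exact: lcs_bracketDr.
- exact: lcs_bracketC.
- exact: lcs_bracketJ.
- exact: ord3S3.
- exact: U_eD.
- exact: U_e_bracket_same.
- exact: serre1.
- exact: serre2.
Qed.

Let span n := span3 s (0 : 'I_3) (n := n) (gr := lcs_factor U_A2t).

Lemma U_gr1_span (y : lcs_factor U_A2t 1) : span e y.
Proof.
case: (lcs_clsP y) => g _ -> {y}.
elim/U_A2t_ind: g => [|i a g IHg].
  by rewrite (_ : lcs_cls 1 1%g = 0) //; apply: span3_0; apply: U_eD.
rewrite lcs_clsM //; apply: (span3D U_eD _ IHg).
change (lcs_cls 1 (xgen i a)) with (e i a).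
apply: span3_mem; [exact: ord3S3|exact: ord3S_case|exact: ord3S_neq|exact: U_eD].
Qed.

Lemma U_tower_span m :
  [/\ forall y, span (U_tower m) y, forall y, span (lev_b br s e (U_tower m)) y
    & forall y, span (lev_h br s e (U_tower m)) y].
Proof.
apply: tower_span.
- exact: lcs_bracketDl.
- exact: lcs_bracketDr.
- exact: lcs_bracketC.
- exact: lcs_bracketJ.
- exact: ord3S3.
- exact: U_eD.
- exact: U_e_bracket_same.
- exact: serre1.
- exact: serre2.
- exact: ord3S_case.
- exact: ord3S_neq.
- exact: U_gr1_span.
move=> n n0 P P0 PD PN Pe; apply: (lcs_factor_ind n0 P0 PD PN) => x y.
have [f ->] := U_gr1_span x; rewrite !lcs_bracketDl //.
by apply: (PD); first apply: (PD).
Qed.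

End NilpotentQuotients.

(** * The congruence filtration and the kernel of phi *)

Section Twist.
Local Open Scope ring_scope.
Local Notation T := 'M[{poly rat}]_3.
Local Notation s := ord3S.
Local Notation iota := (map_mx (@polyC rat)).

Definition E3 (i : 'I_3) : 'M[rat]_3 := delta_mx i (s i).

Definition twist_diag : 'rV[{poly rat}]_3 := \row_i 'X^(2 - i).

Local Notation cube := (map_mx (comp_poly ('X^3 : {poly rat}))).

(** Says that B is the conjugate of A(X^3) by the diagonal matrix without inverting the latter,
    which is not invertible over polynomials. *)
Definition twisted (A B : T) := diag_mx twist_diag *m cube A = B *m diag_mx twist_diag.

Lemma twistedM A B A' B' : twisted A B -> twisted A' B' -> twisted (A *m A') (B *m B').
Proof. by move=> AB AB'; rewrite /twisted map_mxM mulmxA AB -mulmxA AB' mulmxA. Qed.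

Lemma twisted1 : twisted 1%:M 1%:M.
Proof. by rewrite /twisted map_mx1 mulmx1 mul1mx. Qed.

Lemma twist_neq0 i : twist_diag 0 i != 0.
Proof. by rewrite mxE expf_neq0 // polyX_eq0. Qed.

Lemma twisted_inj A B B' : twisted A B -> twisted A B' -> B = B'.
Proof.
rewrite /twisted => -> /matrixP E; apply/matrixP => i j; have := E i j.
by rewrite !mul_mx_diag !mxE; apply: mulIf; have := twist_neq0 j; rewrite mxE.
Qed.

Lemma twisted_injl A A' B : twisted A B -> twisted A' B -> A = A'.
Proof.
move=> E1 E2; have /matrixP E : diag_mx twist_diag *m cube A = diag_mx twist_diag *m cube A'.
  by rewrite E1 E2.
apply/matrixP => i j; have := E i j.
rewrite !mul_diag_mx !mxE => /mulfI H.
have {}H : A i j \Po 'X^3 = A' i j \Po 'X^3.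
  by apply: H; have := twist_neq0 i; rewrite mxE.
by apply/eqP; rewrite -subr_eq0 -(@comp_poly_eq0 _ _ ('X^3)) ?size_polyXn // comp_polyB H subrr.
Qed.

Lemma twisted_gen i (a : rat) :
  twisted (phi_mx i a) (1%:M + 'X *: iota (a *: E3 i)).
Proof.
apply/matrixP => u v; rewrite mul_diag_mx mul_mx_diag.
case: i => -[|[|[|//]]] ?; rewrite /phi_mx /E3 /=;
  case: u v => -[|[|[|//]]] ? [[|[|[|//]]] ?];
  rewrite !mxE /= ?comp_polyC ?comp_poly0 ?comp_polyZ ?comp_polyX;
  rewrite ?mulr0 ?mulr1 ?polyC0 ?polyC1 -?mul_polyC ?expr0 ?expr1; ring.
Qed.

Lemma twisted_phi (g : U_A2t) : exists B, twisted (phi g) B.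
Proof.
elim/U_A2t_ind: g => [|i a g [B gB]].
  by exists 1%:M; rewrite gmulf1; exact: twisted1.
exists ((1%:M + 'X *: iota ((a : rat) *: E3 i)) *m B).
by rewrite gmulfM /= phi_xgen; apply: twistedM => //; apply: twisted_gen.
Qed.

(* [psi g] is the conjugate of phi(g)(t := X^3) by diag(X^2, X, 1), for which
   every generator is congruent to 1 modulo X. *)
Definition psi (g : U_A2t) : T := projT1 (cid (twisted_phi g)).

Lemma psiP g : twisted (phi g) (psi g).
Proof. by rewrite /psi; case: cid. Qed.

Lemma psiM g h : psi (g * h)%g = psi g * psi h.
Proof.
by apply: (twisted_inj (psiP _)); rewrite gmulfM; apply: twistedM; apply: psiP.
Qed.

Lemma psi1 : psi 1%g = 1.
Proof. by apply: (twisted_inj (psiP _)); rewrite gmulf1; apply: twisted1. Qed.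

Lemma psi_xgen i (a : rat) : psi (xgen i a) = 1 + 'X *: iota (a *: E3 i).
Proof. by apply: (twisted_inj (psiP _)); rewrite phi_xgen; apply: twisted_gen. Qed.

Lemma ker_phiE g : ker phi g <-> psi g = 1.
Proof.
split=> [kg|pg]; have := psiP g.
  by rewrite kg => /twisted_inj; apply; apply: twisted1.
by rewrite pg => /twisted_injl H; apply/val_inj/H/twisted1.
Qed.

(** That is, psi(g) = 1 + c X^n modulo X^(n+1). The value c = 0 is allowed, so having some symbol in
    degree n means psi(g) = 1 modulo X^n. *)
Definition symbol n (g : U_A2t) (c : 'M[rat]_3) :=
  exists d : T, psi g = 1 + 'X^n *: (iota c + 'X *: d).

Lemma symbol_uniq n g c c' : symbol n g c -> symbol n g c' -> c = c'.
Proof.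
rewrite /symbol => -[d ->] [d' /addrI/matrixP E]; apply/matrixP => i j.
have /(congr1 (fun p : {poly rat} => p`_n)) := E i j; rewrite !mxE !coefXnM ltnn subnn.
by rewrite !coefD !coefC !coefXM !addr0.
Qed.

Lemma symbolS n g c : symbol n.+1 g c -> symbol n g 0.
Proof.
rewrite /symbol => -[d ->]; exists (iota c + 'X *: d).
by rewrite map_mx0 add0r scalerA -exprSr.
Qed.

Lemma symbolM n g h c c' : (0 < n)%N ->
  symbol n g c -> symbol n h c' -> symbol n (g * h)%g (c + c').
Proof.
case: n => // n _ [d gd] [d' hd'].
exists (d + d' + 'X^n *: ((iota c + 'X *: d) * (iota c' + 'X *: d'))).
rewrite psiM gd hd'; set u := iota c + _; set v := iota c' + _.
rewrite mulrDl mul1r mulrDr mulr1 map_mxD -addrA; congr (_ + _).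
rewrite addrCA addrA -scalerDr -scalerAl -scalerAr.
rewrite -scalerDr; congr (_ *: _).
by rewrite !scalerDr [in RHS]scalerA -exprS addrACA -!addrA.
Qed.

Lemma symbolV n g c : (0 < n)%N -> symbol n g c -> symbol n g^-1%g (- c).
Proof.
case: n => // n _ [d gd].
set u := iota c + _ in gd; set B := psi g^-1%g.
(* With U = psi(g) this is B U = 1 rearranged; substituting it into itself isolates the leading term
   of B. *)
have BU : B = 1 - 'X^(n.+1) *: (B * u).
  have := psiM g^-1%g g; rewrite mulVg psi1 -/B gd mulrDr mulr1 -scalerAr => ->.
  by rewrite addrK.
exists (- d + 'X^n *: (B * u * u)); rewrite -/B {1}BU; congr (_ + _).
rewrite -scalerN; congr (_ *: _); rewrite {1}BU mulrBl mul1r opprB.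
rewrite -scalerAl [in RHS]scalerDr scalerA -exprS addrC map_mxN addrA.
by congr (_ + _); rewrite /u opprD scalerN.
Qed.

Lemma symbol_mul c d c' d' : exists e : T,
  (iota c + 'X *: d) * (iota c' + 'X *: d') = iota (c * c') + 'X *: e.
Proof.
exists (iota c * d' + d * iota c' + 'X *: (d * d')).
have -> : iota (c * c') = iota c * iota c' by exact: map_mxM.
rewrite mulrDl !mulrDr -!scalerAl -!scalerAr !scalerDr -!addrA; congr (_ + _).
Qed.

Lemma symbol1 g : exists c, symbol 1 g c.
Proof.
suff [c [d gd]] : exists c, exists d, psi g = 1 + 'X *: (iota c + 'X *: d).
  by exists c; exists d; rewrite expr1.
elim/U_A2t_ind: g => [|i a g [c [d gd]]].
  by exists 0; exists 0; rewrite psi1 map_mx0 scaler0 addr0 scaler0 addr0.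
suff : symbol 1 (xgen i a * g)%g ((a : rat) *: E3 i + c).
  by move=> [e E]; exists ((a : rat) *: E3 i + c); exists e; rewrite E expr1.
apply: symbolM => //; last by exists d; rewrite expr1.
by exists 0; rewrite psi_xgen expr1 scaler0 addr0.
Qed.

(** Writing psi(g) = 1 + X^p u and psi(h) = 1 + X^q v, one has psi([g, h]) = 1 + X^(p+q)
    psi((hg)^-1) (uv - vu), and the factor psi((hg)^-1) is 1 modulo X. *)
Lemma symbolR p q g h c c' : (0 < p)%N -> (0 < q)%N ->
  symbol p g c -> symbol q h c' -> symbol (p + q) [~ g, h]%g (c * c' - c' * c).
Proof.
move=> p0 q0 [d gd] [d' hd'].
have [w [dw W]] := symbol1 (h * g)^-1%g.
have [e1 E1] := symbol_mul c d c' d'; have [e2 E2] := symbol_mul c' d' c d.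
have E : psi [~ g, h]%g = 1 + 'X^(p + q) *: (psi (h * g)^-1%g *
   (iota (c * c' - c' * c) + 'X *: (e1 - e2))).
  have cancel x : psi (h * g)^-1%g * (psi (h * g)%g * x) = x.
    by rewrite mulrA -psiM mulVg psi1 mul1r.
  rewrite -[psi [~ g, h]%g]cancel -psiM -commgC psiM gd hd'.
  rewrite -[X in _ = X + _](cancel 1) mulr1 psiM gd hd' scalerAr -mulrDr.
  congr (_ * _); set u := iota c + _ in E1 E2 *; set v := iota c' + _ in E1 E2 *.
  have -> : iota (c * c' - c' * c) + 'X *: (e1 - e2) = u * v - v * u.
    by rewrite E1 E2 map_mxB scalerBr opprD addrACA.
  clearbody u v.
  rewrite !mulrDl !mul1r !mulrDr !mulr1 -!scalerAl -!scalerAr !scalerA -!exprD.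
  rewrite [(q + p)%N]addnC scalerBr -!addrA; congr (_ + _).
  by rewrite ['X^_ *: (v * u) + _]addrC subrK addrCA.
rewrite /symbol E W; set K := iota (_ - _); set y := iota w + _.
exists (e1 - e2 + y * (K + 'X *: (e1 - e2))); congr (_ + _ *: _).
by rewrite mulrDl mul1r expr1 -scalerAl -addrA [in RHS]scalerDr.
Qed.

Lemma lcs_symbol n g : (0 < n)%N -> lcs U_A2t n g -> exists c, symbol n g c.
Proof.
case: n => // n _; elim: n g => [|n IHn] g; first by move=> _; apply: symbol1.
move: g; apply: generated_sub.
  split=> [|g h [c gc] [c' hc']].
    by exists 0; exists 0; rewrite psi1 map_mx0 !scaler0 !addr0 scaler0 addr0.
  by exists (c - c'); apply: symbolM => //; apply: symbolV.
move=> _ [g _ [h Lh <-]]; have [c gc] := symbol1 g; have [c' hc'] := IHn h Lh.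
by exists (c * c' - c' * c); rewrite -add1n; apply: symbolR.
Qed.

(** Membership in gamma_(k+1) kills the coefficient of X^k in psi(g) - 1, and k is arbitrary. *)
Lemma residual_sub_ker : (nilpotent_residual U_A2t `<=` ker phi)%classic.
Proof.
move=> g Lg; apply/ker_phiE/matrixP => i j; apply/polyP => k.
have [c [d ->]] := lcs_symbol (ltn0Sn k) (Lg k.+1 isT).
by rewrite !mxE coefD coefXnM ltnSn addr0.
Qed.

(** * Symbols of the spanning families *)

Definition gr_symbol n (y : lcs_factor U_A2t n) (c : 'M[rat]_3) :=
  exists g, [/\ lcs U_A2t n g, y = lcs_cls n g & symbol n g c].

(** Two representatives of a class differ by an element of gamma_(n+1), whose symbol in degree n is
    0. *)
Lemma gr_symbolE n g c : (0 < n)%N -> lcs U_A2t n g ->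
  gr_symbol (lcs_cls n g) c -> symbol n g c.
Proof.
move=> n0 Lg [h [Lh Egh hc]].
have D : lcs U_A2t n.+1 (h^-1 * g)%g by apply/lcs_cls_eq.
have [c' /symbolS D0] := lcs_symbol (ltn0Sn n) D.
by have := symbolM n0 hc D0; rewrite mulVKg addr0.
Qed.

Lemma gr_symbolD n y z c c' : (0 < n)%N ->
  gr_symbol y c -> gr_symbol z c' -> gr_symbol (y + z : lcs_factor U_A2t n) (c + c').
Proof.
move=> n0 [g [Lg -> gc]] [h [Lh -> hc]]; exists (g * h)%g.
by split; [apply: lcsM|rewrite lcs_clsM|apply: symbolM].
Qed.

Lemma gr_symbolR p q n y z c c' : (0 < p)%N -> (0 < q)%N -> n = (p + q)%N ->
  @gr_symbol p y c -> @gr_symbol q z c' ->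
  gr_symbol (lcs_bracket n y z) (c * c' - c' * c).
Proof.
move=> p0 q0 -> [g [Lg -> gc]] [h [Lh -> hc]]; exists [~ g, h]%g.
by split; [apply: lcs_comm|rewrite lcs_clsR|apply: symbolR].
Qed.

Local Notation br := (@lcs_bracket U_A2t).
Local Notation b m := (lev_b br s U_e (U_tower m)).
Local Notation h m := (lev_h br s U_e (U_tower m)).

Lemma gr_symbol_e i a : gr_symbol (U_e i a) (a *: E3 i).
Proof.
exists (xgen i a); split=> //.
by exists 0; rewrite psi_xgen expr1 scaler0 addr0.
Qed.

Lemma gr_symbol_D n i (y : lcs_factor U_A2t n) a c : (0 < n)%N ->
  gr_symbol y (a *: c) -> gr_symbol (D br U_e i y) (a *: (E3 i * c - c * E3 i)).
Proof.
move=> n0 yc; have := gr_symbolR (p := 1) isT n0 erefl (gr_symbol_e i 1) yc.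
by rewrite scale1r -scalerAr -scalerAl -scalerBr.
Qed.

Lemma gr_symbol_b n (x : 'I_3 -> rat -> lcs_factor U_A2t n) : (0 < n)%N ->
  (forall i a, gr_symbol (x i a) (a *: E3 i)) ->
  forall i a, gr_symbol (lev_b br s U_e x i a) (a *: delta_mx (s i) i).
Proof.
move=> n0 xE i a; have := gr_symbol_D (s i) n0 (xE (s (s i)) a).
rewrite /E3 ord3S3.
have -> : delta_mx (s i) (s (s i)) * delta_mx (s (s i)) i = delta_mx (s i) i :> 'M[rat]_3.
  exact: mul_delta_mx.
have -> : delta_mx (s (s i)) i * delta_mx (s i) (s (s i)) = 0 :> 'M[rat]_3.
  by apply: mul_delta_mx_0; rewrite eq_sym ord3S_neq.
by rewrite subr0.
Qed.

Lemma gr_symbol_h n (x : 'I_3 -> rat -> lcs_factor U_A2t n) : (0 < n)%N ->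
  (forall i a, gr_symbol (x i a) (a *: E3 i)) ->
  forall i a, gr_symbol (lev_h br s U_e x i a)
    (a *: (delta_mx i i - delta_mx (s i) (s i))).
Proof.
move=> n0 xE i a; have := gr_symbol_D i (ltn0Sn n) (gr_symbol_b n0 xE i a).
have -> : E3 i * delta_mx (s i) i = delta_mx i i by exact: mul_delta_mx.
by have -> : delta_mx (s i) i * E3 i = delta_mx (s i) (s i) by exact: mul_delta_mx.
Qed.

Lemma gr_symbol_tower m i a : gr_symbol (U_tower m i a) (a *: E3 i).
Proof.
elim: m i a => [|m IHm] i a; first exact: gr_symbol_e.
have m0 : (0 < deg m)%N by rewrite degE.
have := gr_symbol_D i (ltn0Sn (deg m).+1) (gr_symbol_h m0 IHm (s i) a).
have -> : E3 i * (delta_mx (s i) (s i) - delta_mx (s (s i)) (s (s i))) = E3 i.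
  rewrite mulrBr; have -> : E3 i * delta_mx (s i) (s i) = E3 i by exact: mul_delta_mx.
  have -> : E3 i * delta_mx (s (s i)) (s (s i)) = 0.
    by apply: mul_delta_mx_0; rewrite eq_sym ord3S_neq.
  by rewrite subr0.
have -> : (delta_mx (s i) (s i) - delta_mx (s (s i)) (s (s i))) * E3 i = 0 :> 'M[rat]_3.
  rewrite mulrBl; have -> : delta_mx (s i) (s i) * E3 i = 0 :> 'M[rat]_3.
    by apply: mul_delta_mx_0; rewrite ord3S_neq.
  have -> : delta_mx (s (s i)) (s (s i)) * E3 i = 0 :> 'M[rat]_3.
    by apply: mul_delta_mx_0; rewrite -[X in _ != X]ord3S3 eq_sym ord3S_neq.
  by rewrite subr0.
by rewrite subr0.
Qed.

Lemma gr_symbol_ker n g c : (0 < n)%N -> lcs U_A2t n g -> ker phi g ->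
  gr_symbol (lcs_cls n g) c -> c = 0.
Proof.
move=> n0 Lg /ker_phiE pg /(gr_symbolE n0 Lg) /symbol_uniq; apply.
by exists 0; rewrite pg map_mx0 !scaler0 !addr0 scaler0 addr0.
Qed.

Lemma U_towerD m i a b : U_tower m i (a + b) = U_tower m i a + U_tower m i b.
Proof. exact: (towerD (@lcs_bracketDr _) _ U_eD). Qed.

Local Notation "'i0'" := (0 : 'I_3).

(** Each coefficient f i is the entry (i, s i) of the symbol, and the symbol vanishes on the
    kernel. *)
Lemma ker_phi_a m g : lcs U_A2t (deg m) g -> ker phi g -> lcs U_A2t (deg m).+1 g.
Proof.
move=> Lg kg; apply/lcs_cls_eq0 => //.
have [f Ef] := (let: And3 H _ _ := U_tower_span m in H) (lcs_cls (deg m) g).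
have n0 : (0 < deg m)%N by rewrite degE.
have H i := gr_symbol_tower m i (f i).
have := gr_symbolD n0 (gr_symbolD n0 (H i0) (H (s i0))) (H (s (s i0))).
rewrite -Ef => /(gr_symbol_ker n0 Lg kg)/matrixP E.
have f0 i : f i = 0.
  have := E i (s i); rewrite !mxE.
  by case: (ord3S_case i0 i) => ->; rewrite /= ?mulr1 ?mulr0 ?addr0 ?add0r.
by rewrite Ef !f0 !(family0 (U_towerD m)) !addr0.
Qed.

Lemma ker_phi_b m g : lcs U_A2t (deg m).+1 g -> ker phi g -> lcs U_A2t (deg m).+2 g.
Proof.
move=> Lg kg; apply/lcs_cls_eq0 => //.
have [f Ef] := (let: And3 _ H _ := U_tower_span m in H) (lcs_cls (deg m).+1 g).
have n0 : (0 < deg m)%N by rewrite degE.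
have H i := gr_symbol_b n0 (gr_symbol_tower m) i (f i).
have h0 := ltn0Sn (deg m).
have := gr_symbolD h0 (gr_symbolD h0 (H i0) (H (s i0))) (H (s (s i0))).
rewrite -Ef => /(gr_symbol_ker (ltn0Sn (deg m)) Lg kg)/matrixP E.
have f0 i : f i = 0.
  have := E (s i) i; rewrite !mxE.
  by case: (ord3S_case i0 i) => ->; rewrite /= ?mulr1 ?mulr0 ?addr0 ?add0r.
have bD i a c : b m i (a + c) = b m i a + b m i c.
  by apply: lev_bD; [exact: lcs_bracketDr | exact: U_towerD].
by rewrite Ef !f0 !(family0 bD) !addr0.
Qed.

(** The three diagonal symbols sum to zero, so a vanishing symbol only forces the coefficients to be
    equal; [rel_h] then kills the class. *)
Lemma ker_phi_h m g : lcs U_A2t (deg m).+2 g -> ker phi g -> lcs U_A2t (deg m).+3 g.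
Proof.
move=> Lg kg; apply/lcs_cls_eq0 => //.
have [f Ef] := (let: And3 _ _ H := U_tower_span m in H) (lcs_cls (deg m).+2 g).
have n0 : (0 < deg m)%N by rewrite degE.
have H i := gr_symbol_h n0 (gr_symbol_tower m) i (f i).
have h0 := ltn0Sn (deg m).+1.
have := gr_symbolD h0 (gr_symbolD h0 (H i0) (H (s i0))) (H (s (s i0))).
rewrite -Ef => /(gr_symbol_ker (ltn0Sn (deg m).+1) Lg kg)/matrixP E.
have f01 : f (s i0) = f i0.
  have := E (s i0) (s i0); rewrite !mxE /= => /eqP; rewrite ?subr0 ?sub0r ?mulr1 ?mulr0.
  by lra.
have f02 : f (s (s i0)) = f i0.
  have := E i0 i0; rewrite !mxE /= => /eqP; lra.
by rewrite Ef f01 f02; apply: (rels_h (U_tower_rels m)).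
Qed.

Theorem ker_phi_residual : ker phi = nilpotent_residual U_A2t.
Proof.
apply/seteqP; split; last exact: residual_sub_ker.
move=> g kg n _.
have lcs_le k p : lcs U_A2t (k + p) g -> lcs U_A2t p g.
  by elim: k => // k IHk /lcsS.
(* Since n <= deg n, it suffices to reach gamma_(deg n); the induction starts at gamma_1, the whole
   group. *)
suff /lcs_le : lcs U_A2t (deg n - n + n) g by [].
rewrite subnK; last by rewrite degE; lia.
elim: n => // n IHn.
by apply: ker_phi_h => //; apply: ker_phi_b => //; apply: ker_phi_a.
Qed.

End Twist.

(** * The development of the triangle of Heisenberg groups *)

Section Chambers.
Local Open Scope ring_scope.

Definition heis : Type := (rat * rat * rat)%type.

(* Exponential coordinates: (a, b, z) is exp(a x + b y + z [x, y]). *)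
Definition hmul (g h : heis) : heis :=
  let: (a, b, z) := g in let: (a', b', z') := h in
  (a + a', b + b', z + z' + (a * b' - b * a') / 2%:R).

Local Notation "g ⋅ h" := (hmul g h) (at level 40, left associativity).

Definition hX (s : bool) (a : rat) : heis := if s then (0, a, 0) else (a, 0, 0).
Definition hco (s : bool) (h : heis) : rat := if s then h.1.2 else h.1.1.

Definition hsg (s : bool) : rat := if s then -1 else 1.

(* Membership in the product set of the two root groups, in the order s, ~~ s. *)
Definition hprod s (h : heis) : bool :=
  h.2 == hsg s * hco s h * hco (~~ s) h / 2%:R.

Ltac heis_tac := rewrite /hmul /hX /hco /hprod /hsg /=;
  try (congr (_, _, _)); try by field.

Lemma hmulA g h k : g ⋅ (h ⋅ k) = g ⋅ h ⋅ k.
Proof. by case: g h k => -[a b] z [[a' b'] z'] [[a'' b''] z'']; heis_tac. Qed.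

Lemma hmul1 h : h ⋅ (0, 0, 0) = h.
Proof. by case: h => -[a b] z; heis_tac. Qed.

Lemma hX0 s : hX s 0 = (0, 0, 0). Proof. by case: s. Qed.

Lemma hmul1g h : (0, 0, 0) ⋅ h = h.
Proof. by case: h => -[a b] z; heis_tac. Qed.

Lemma hmulX0 h s : h ⋅ hX s 0 = h.
Proof. by rewrite hX0 hmul1. Qed.

Lemma hXD s a b : hX s a ⋅ hX s b = hX s (a + b).
Proof. by case: s; heis_tac. Qed.

Lemma hmulXD h s a b : h ⋅ hX s a ⋅ hX s b = h ⋅ hX s (a + b).
Proof. by rewrite -hmulA hXD. Qed.

Lemma hcoX h s a : hco s (h ⋅ hX s a) = hco s h + a.
Proof. by case: h s => -[? ?] ? []; heis_tac. Qed.

Lemma hcoXN h s a : hco (~~ s) (h ⋅ hX s a) = hco (~~ s) h.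
Proof. by case: h s => -[? ?] ? []; heis_tac. Qed.

Definition hmid s g u a : heis := hX (~~ s) g ⋅ hX s u ⋅ hX (~~ s) a.

(** With [hright], the outer parameters when h is factored as X_s X_(~~ s) X_s with nonzero middle
    parameter; see [hmid_decomp]. *)
Definition hleft s h := (hco s h + 2%:R * hsg s * h.2 / hco (~~ s) h) / 2%:R.
Definition hright s h := (hco s h - 2%:R * hsg s * h.2 / hco (~~ s) h) / 2%:R.

Lemma hmid_decomp s h : hco (~~ s) h != 0 ->
  hmid (~~ s) (hleft s h) (hco (~~ s) h) (hright s h) = h.
Proof.
by case: h s => -[a b] z []; rewrite /hmid /hleft /hright /hco /= => n0; heis_tac.
Qed.

Lemma hleft_mid s g u a : u != 0 -> hleft (~~ s) (hmid s g u a) = g.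
Proof. by case: s => n0; rewrite /hleft /hmid; heis_tac. Qed.

Lemma hright_mid s g u a : u != 0 -> hright (~~ s) (hmid s g u a) = a.
Proof. by case: s => n0; rewrite /hright /hmid; heis_tac. Qed.

Lemma hco_mid s g u a : hco s (hmid s g u a) = u.
Proof. by case: s; rewrite /hmid; heis_tac. Qed.

Lemma hprodP s h : reflect (h = hX s (hco s h) ⋅ hX (~~ s) (hco (~~ s) h)) (hprod s h).
Proof.
case: h s => -[a b] z []; apply: (iffP eqP);
  rewrite /hmul /hX /hco /hsg /=; try by move=> ->; congr (_, _, _); field.
- by move=> /(congr1 snd) /= ->; field.
- by move=> /(congr1 snd) /= ->; field.
Qed.

Lemma hprod_XX s a b : hprod s (hX s a ⋅ hX (~~ s) b).
Proof. by case: s; rewrite /hprod; heis_tac; apply/eqP; by field. Qed.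

Lemma hco_XX s a b : hco s (hX s a ⋅ hX (~~ s) b) = a.
Proof. by case: s; heis_tac. Qed.

Lemma hcoN_XX s a b : hco (~~ s) (hX s a ⋅ hX (~~ s) b) = b.
Proof. by case: s; heis_tac. Qed.

Lemma hprod_mid s g u a : hprod s (hmid s g u a) = (g * u == 0).
Proof.
by rewrite /hprod /hmid; case: s; heis_tac; apply/eqP/eqP => E; lra.
Qed.

Lemma hprodN_mid s g u a : hprod (~~ s) (hmid s g u a) = (u * a == 0).
Proof.
by rewrite /hprod /hmid; case: s; heis_tac; apply/eqP/eqP => E; lra.
Qed.

Lemma hprodN_X h s a : hprod (~~ s) (h ⋅ hX s a) = hprod (~~ s) h.
Proof.
by rewrite /hprod; case: h s => -[? ?] ? []; heis_tac; apply/eqP/eqP => E; lra.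
Qed.

Lemma hprod_X h s a : hco (~~ s) h = 0 -> hprod s (h ⋅ hX s a) = hprod s h.
Proof.
rewrite /hprod; case: h s => -[? ?] ? []; heis_tac => ->;
  by apply/eqP/eqP => E; lra.
Qed.

(* Around the root vertex, each other vertex v has a projection to the previous
   layer: the vertex v0 for [VLine v0 s h], where v lies on the panel of type s
   of the chamber h at v0, or an edge for [VEdge v0 h u], where the chamber h
   at v0 is moved by u <> 0 along its panel opposite to v0, and v is the new vertex. [CRoot v h] is the chamber with coordinate h at its lowest vertex v;
   [CNext v0 h u] is the chamber with top vertex [VEdge v0 h u]. *)
Inductive vertex :=
  | Root
  | VLine of vertex & bool & heis
  | VEdge of vertex & heis & rat.

Inductive chamber :=
  | CRoot of vertex & heis
  | CNext of vertex & heis & rat.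

(* A vertex missing m has the root groups of index m + 1 (s = false) and m + 2
   (s = true); indices are modulo 3. *)
Definition line_idx (m : 'I_3) (s : bool) : 'I_3 :=
  if s then ord3S (ord3S m) else ord3S m.

Lemma line_idxN m s : line_idx (line_idx m (~~ s)) (~~ s) = line_idx m s.
Proof. by case: s; rewrite /line_idx /= ?ord3S3. Qed.

Lemma line_idxK m s : line_idx (line_idx m (~~ s)) s = m.
Proof. by case: s; rewrite /line_idx /= ord3S3. Qed.

Definition idx_pos (m i : 'I_3) : option bool :=
  if i == m then None else Some (i != ord3S m).

Lemma idx_posE m s : idx_pos m (line_idx m s) = Some s.
Proof.
rewrite /idx_pos; case: s => /=; last by rewrite ord3S_neq eqxx.
by rewrite -{2}[m]ord3S3 eq_sym ord3S_neq ord3S_neq.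
Qed.

Lemma idx_pos_refl m : idx_pos m m = None.
Proof. by rewrite /idx_pos eqxx. Qed.

(** The root vertex belongs to U_1 and U_2. The two ends of a panel of type s share its root group
    and miss the two other indices. *)
Fixpoint miss v : 'I_3 :=
  match v with
  | Root => ord3S (ord3S 0)
  | VLine v s _ => line_idx (miss v) (~~ s)
  | VEdge v _ _ => miss v
  end.

(* Coordinates at v of the chambers whose lowest vertex is v. *)
Definition region v (h : heis) : bool :=
  match v with
  | Root => true
  | VLine _ s _ => ~~ hprod (~~ s) h
  | VEdge _ _ _ => ~~ hprod false h && ~~ hprod true h
  end.

(* For a chamber in [region v]: its panel of type s lies at distance at least 3
   from the projection of v in the link, so that v is the projection of the other
   end of this panel. *)
Definition far v (h : heis) (s : bool) : bool :=
  match v with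
  | Root => true
  | VLine _ s0 _ => (s == s0) || (hco (~~ s) h == 0)
  | VEdge _ _ _ => hco (~~ s) h == 0
  end.

(* The other end v' of the panel of type s, and the coordinate of the chamber on
   that panel in the chart at v'. The value at a near panel of [Root] is junk. *)
Fixpoint top v (h : heis) (s : bool) : vertex * rat :=
  if far v h s then (VLine v s (h ⋅ hX s (- hco s h)), hco s h) else
  let q := hco (~~ s) h in
  match v with
  | Root => (Root, 0)
  | VLine v0 s0 h0 => (VEdge v0 (h0 ⋅ hX s0 (hleft s h)) q, hright s h)
  | VEdge v0 h0 u => let: (v', g) := top v0 h0 s in
      (VEdge v' (hmid s g u (hleft s h)) q, hright s h)
  end.

(** The condition [hco s h == 0] selects one chamber of the panel to name the vertex
    [VLine v s h]. *)
Fixpoint wfv v : bool :=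
  match v with
  | Root => true
  | VLine v s h => [&& wfv v, region v h, far v h s & hco s h == 0]
  | VEdge v h u => [&& wfv v, region v h & u != 0]
  end.

(** The chamber with coordinate X_s(a) X_(~~ s)(c) at [VEdge v h u], for nonzero a, described from
    the other end v' of the panel of type s of the chamber h at v. *)
Definition chartE v h u (s : bool) (a c : rat) : chamber :=
  let: (v', g) := top v h s in
  if c == 0 then CRoot v' (hmid s g u a) else CNext v' (hmid s g u a) c.

(* The chambers containing v form a torsor under the Heisenberg group; [chart v h]
   is the one with coordinate h. *)
Definition chart v (h : heis) : chamber :=
  match v with
  | Root => CRoot v h
  | VLine v0 s h0 =>
      if hprod (~~ s) h then
        let b := h0 ⋅ hX s (hco (~~ s) h) in
        if hco s h == 0 then CRoot v0 b else CNext v0 b (hco s h)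
      else CRoot v h
  | VEdge v0 h0 u =>
      if h == (0, 0, 0) then CNext v0 h0 u else
      if hprod false h && (hco false h != 0) then
        chartE v0 h0 u false (hco false h) (hco true h) else
      if hprod true h then chartE v0 h0 u true (hco true h) (hco false h)
      else CRoot v h
  end.

(** A right action: a root group of the lowest vertex v translates the coordinate at v, and the
    missing one moves the chamber along its panel opposite to v. *)
Definition act (i : 'I_3) (a : rat) (c : chamber) : chamber :=
  match c with
  | CRoot v h =>
      if idx_pos (miss v) i is Some s then chart v (h ⋅ hX s a)
      else if a == 0 then c else CNext v h a
  | CNext v h u =>
      if idx_pos (miss v) i is Some s then
        if a == 0 then c else
        let: (v', g) := top v h s in CRoot v' (hmid s g u a)
      else if u + a == 0 then CRoot v h else CNext v h (u + a)
  end.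

Definition wfc (c : chamber) : bool :=
  match c with
  | CRoot v h => wfv v && region v h
  | CNext v h u => [&& wfv v, region v h & u != 0]
  end.

(** * Normal forms in the link of a vertex *)

Lemma region_midE v h u s g a c : g != 0 -> a != 0 -> c != 0 ->
  region (VEdge v h u) (hmid s g a c).
Proof.
move=> g0 a0 c0 /=; have := hprod_mid s g a c; have := hprodN_mid s g a c.
rewrite !mulf_eq0 (negPf g0) (negPf a0) (negPf c0).
by case: s => /= -> ->.
Qed.

Lemma region_midV v h s g u a : u != 0 -> a != 0 ->
  region (VLine v s h) (hmid s g u a).
Proof. by move=> u0 a0 /=; rewrite hprodN_mid mulf_neq0. Qed.

Lemma regionE v h u k s : region (VEdge v h u) k -> ~~ hprod s k.
Proof. by case/andP; case: s. Qed.

Lemma hprod0 s : hprod s (0, 0, 0).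
Proof. by case: s; rewrite /hprod /= !(mulr0, mul0r). Qed.

Lemma hprodN_XX s a b : hprod (~~ s) (hX s a ⋅ hX (~~ s) b) = (a * b == 0).
Proof.
by rewrite /hprod; case: s; heis_tac; apply/eqP/eqP => E; lra.
Qed.

Lemma chart_region v h : region v h -> chart v h = CRoot v h.
Proof.
case: v => //= [v0 s h0 /negPf -> //|v0 h0 u R].
case: eqP => [E|_]; first by rewrite E hprod0 in R.
by case/andP: R => /negPf -> /negPf ->.
Qed.

Lemma chart_VLine v s h a c : chart (VLine v s h) (hX (~~ s) a ⋅ hX s c) =
  if c == 0 then CRoot v (h ⋅ hX s a) else CNext v (h ⋅ hX s a) c.
Proof.
have := hprod_XX (~~ s) a c; have := hco_XX (~~ s) a c.
by have := hcoN_XX (~~ s) a c; rewrite negbK /= => -> -> ->.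
Qed.

Lemma chart_VEdge1 v h u : chart (VEdge v h u) (0, 0, 0) = CNext v h u.
Proof. by []. Qed.

Lemma chart_VEdge v h u s a c : a != 0 ->
  chart (VEdge v h u) (hX s a ⋅ hX (~~ s) c) = chartE v h u s a c.
Proof.
move=> a0; set k := _ ⋅ _.
have k0 : (k == (0, 0, 0)) = false.
  apply/eqP => /(congr1 (hco s)); rewrite hco_XX => E.
  by move: a0; rewrite E; case: (s).
rewrite /= k0; have := hco_XX s a c; have := hcoN_XX s a c.
have := hprod_XX s a c; have := hprodN_XX s a c; rewrite -/k.
case: s {k0} @k => /= E1 E2 E3 E4; last by rewrite E2 E3 E4 a0.
rewrite E1 E2 E3 E4 mulf_eq0 (negPf a0) /=.
by case: eqP => // ->.
Qed.

Lemma heisE_case k :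
  [\/ k = (0, 0, 0), exists s a c, a != 0 /\ k = hX s a ⋅ hX (~~ s) c
    | ~~ hprod false k && ~~ hprod true k].
Proof.
have [p|np] := boolP (hprod false k); last have [p|np'] := boolP (hprod true k).
- have E : k = hX false (hco false k) ⋅ hX true (hco true k).
    exact: (hprodP false k p).
  have [a0|a0] := eqVneq (hco false k) 0.
    have [b0|b0] := eqVneq (hco true k) 0.
      by apply: Or31; rewrite E a0 b0 !hX0 hmul1.
    apply: Or32; exists true, (hco true k), 0; split=> //.
    by rewrite [LHS]E a0 !hX0 hmul1 hmul1g.
  by apply: Or32; exists false, (hco false k), (hco true k).
- have E : k = hX true (hco true k) ⋅ hX false (hco false k).
    exact: (hprodP true k p).
  have [b0|b0] := eqVneq (hco true k) 0.
    case/negP: np; rewrite E b0 hX0 hmul1g -[hX _ _]hmul1 -(hX0 true).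
    exact: (hprod_XX false _ 0).
  by apply: Or32; exists true, (hco true k), (hco false k).
- by apply: Or33; rewrite ?np ?np'.
Qed.

Lemma heisV_case t k :
  (exists a c, k = hX (~~ t) a ⋅ hX t c) \/ ~~ hprod (~~ t) k.
Proof.
case: (hprodP (~~ t) k) => [E|]; last by right.
by left; exists (hco (~~ t) k), (hco t k); rewrite {1}E negbK.
Qed.

Lemma region_line v h s a : region v h -> far v h s -> region v (h ⋅ hX s a).
Proof.
case: v => //= [v0 s0 h0|v0 h0 u].
  case: (eqVneq s s0) => [<- R _|ss0 R /eqP h0c]; first by rewrite hprodN_X.
  have E : s = ~~ s0 by case: s s0 ss0 {R h0c} => -[].
  by rewrite -E hprod_X // E.
move=> /andP[R0 R1] /eqP h0c.
have RX : hprod s (h ⋅ hX s a) = hprod s h by rewrite hprod_X.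
by have := hprodN_X h s a; case: s {h0c} RX => /= -> ->; rewrite R0 R1.
Qed.

Lemma far_line v h s a : far v (h ⋅ hX s a) s = far v h s.
Proof. by case: v => //= *; rewrite hcoXN. Qed.

Lemma top_far v h s : far v h s ->
  top v h s = (VLine v s (h ⋅ hX s (- hco s h)), hco s h).
Proof. by case: v => //= *; rewrite ifT. Qed.

Lemma top_line v s h a : far v h s -> hco s h = 0 ->
  top v (h ⋅ hX s a) s = (VLine v s h, a).
Proof.
move=> F h0; rewrite top_far ?far_line // hcoX h0 add0r.
by rewrite hmulXD subrr hmulX0.
Qed.

Lemma near_VLine v0 s0 h0 h s : far (VLine v0 s0 h0) h s = false ->
  s = ~~ s0 /\ hco (~~ s) h != 0.
Proof. by move=> /= /norP; case: s s0 => -[] [] //. Qed.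

Lemma region_left v h u k s : region (VEdge v h u) k -> hco (~~ s) k != 0 ->
  hleft s k != 0.
Proof.
move=> R k0; apply/eqP => l0; have := regionE (~~ s) R; rewrite -(hmid_decomp k0) l0.
by rewrite hprod_mid mul0r eqxx.
Qed.

Lemma region_right v k s : region v k -> far v k s = false -> hright s k != 0.
Proof.
case: v => // [v0 s0 h0|v0 h0 u] R F.
  have [E k0] := near_VLine F; apply/eqP => l0; case/negP: R.
  by rewrite -(hmid_decomp k0) l0 -E -[X in hprod X]negbK hprodN_mid mulr0 eqxx.
have k0 : hco (~~ s) k != 0 by rewrite /= in F; rewrite F.
apply/eqP => l0; have := regionE s R; rewrite -(hmid_decomp k0) l0.
by rewrite -[X in hprod X]negbK hprodN_mid mulr0 eqxx.
Qed.

Lemma top_midV v s h g u p : u != 0 ->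
  top (VLine v s h) (hmid s g u p) (~~ s) = (VEdge v (h ⋅ hX s g) u, p).
Proof.
move=> u0; rewrite /= negbK hco_mid (negPf u0) orbF ifF; last by case: (s).
by rewrite hleft_mid // hright_mid.
Qed.

Lemma top_midE v h u0 s g u p : u != 0 ->
  top (VEdge v h u0) (hmid s g u p) (~~ s) =
  let: (v', g') := top v h (~~ s) in (VEdge v' (hmid (~~ s) g' u0 g) u, p).
Proof.
move=> u0n; rewrite /= negbK hco_mid (negPf u0n).
by rewrite hleft_mid // hright_mid.
Qed.

Lemma top_nearV v s0 h0 h s : far (VLine v s0 h0) h s = false ->
  top (VLine v s0 h0) h s =
  (VEdge v (h0 ⋅ hX s0 (hleft s h)) (hco (~~ s) h), hright s h).
Proof. by move=> /= ->. Qed.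

Lemma top_nearE v h0 u h s : far (VEdge v h0 u) h s = false ->
  top (VEdge v h0 u) h s =
  let: (v', g) := top v h0 s in
  (VEdge v' (hmid s g u (hleft s h)) (hco (~~ s) h), hright s h).
Proof. by move=> /= ->. Qed.

(* Consistency of the gluing: an edge-projected vertex has two vertices below it,
   and it is described in the same way from both. *)
Lemma top_mid v h s u p : wfv v -> region v h -> u != 0 -> p != 0 ->
  let: (v', g) := top v h s in
  top v' (hmid s g u p) (~~ s) = (VEdge v h u, p).
Proof.
elim: v h s u p => [|v IHv s0 h0|v IHv h0 u0] h s u p wf R un0 pn0.
- by rewrite top_far // top_midV // hmulXD addNr hmulX0.
- have [F|F] := boolP (far (VLine v s0 h0) h s).
    by rewrite top_far // top_midV // hmulXD addNr hmulX0.
  move/negPf in F; have [E q0] := near_VLine F.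
  case/and4P: wf => wf R0 F0 /eqP h00.
  rewrite top_nearV // top_midE //.
  have -> : ~~ s = s0 by rewrite E negbK.
  rewrite top_line //; congr (VEdge _ _ _, _).
  by rewrite -[s0]negbK -E; exact: hmid_decomp.
have [F|F] := boolP (far (VEdge v h0 u0) h s).
  by rewrite top_far // top_midV // hmulXD addNr hmulX0.
have q0 : hco (~~ s) h != 0 by [].
have p0 := region_left R q0.
case/and3P: wf => wf R0 u0n0.
rewrite (top_nearE (negPf F)).
have := IHv h0 s u0 _ wf R0 u0n0 p0; case: (top v h0 s) => v' g E.
by rewrite top_midE // E hmid_decomp.
Qed.

(** At a far panel this is how [chart] is defined. At a near panel the other end is a [VEdge], and
    reading its chart through a lower vertex leads back to v by [top_line] or [top_mid]. *)
Lemma chart_top v h s : wfv v -> region v h ->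
  let: (v', g) := top v h s in
  chart v' (hX (~~ s) g) = CRoot v h /\
  forall u, u != 0 -> chart v' (hX (~~ s) g ⋅ hX s u) = CNext v h u.
Proof.
move=> wf R; have [F|F] := boolP (far v h s).
  rewrite top_far //; split=> [|u u0].
    by rewrite -[hX (~~ s) _](hmulX0 _ s) chart_VLine eqxx hmulXD addNr hmulX0.
  by rewrite chart_VLine (negPf u0) hmulXD addNr hmulX0.
move/negPf in F; have r0 := region_right R F.
case: v wf R F => [//|v0 s0 h0|v0 h0 u0] wf R F.
  have [E q0] := near_VLine F; subst s; case/and4P: wf => wf R0 F0 /eqP h00.
  rewrite top_nearV // negbK in q0 *.
  have K c : chart (VEdge v0 (h0 ⋅ hX s0 (hleft (~~ s0) h)) (hco s0 h))
      (hX s0 (hright (~~ s0) h) ⋅ hX (~~ s0) c) =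
      if c == 0 then CRoot (VLine v0 s0 h0) h else CNext (VLine v0 s0 h0) h c.
    rewrite chart_VEdge // /chartE top_line //.
    by have := @hmid_decomp (~~ s0) h; rewrite negbK => ->.
  split=> [|u u0]; last by rewrite K (negPf u0).
  by rewrite -[hX _ (hright _ _)](hmulX0 _ (~~ s0)) K eqxx.
case/and3P: wf => wf R0 u0n0.
have q0 : hco (~~ s) h != 0 by rewrite /= in F; rewrite F.
rewrite (top_nearE F); have := top_mid s wf R0 u0n0 (region_left R q0).
case: (top v0 h0 s) => v' g T.
have K c : chart (VEdge v' (hmid s g u0 (hleft s h)) (hco (~~ s) h))
    (hX (~~ s) (hright s h) ⋅ hX s c) =
    if c == 0 then CRoot (VEdge v0 h0 u0) h else CNext (VEdge v0 h0 u0) h c.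
  by rewrite -[X in _ ⋅ hX X _]negbK chart_VEdge // /chartE T hmid_decomp.
split=> [|u un0]; last by rewrite K (negPf un0).
by rewrite -[hX _ (hright _ _)](hmulX0 _ s) K eqxx.
Qed.

Lemma wf_top_far v h s : wfv v -> region v h -> far v h s ->
  wfv (VLine v s (h ⋅ hX s (- hco s h))).
Proof.
move=> wf R F; apply/and4P; split=> //; first exact: region_line.
- by rewrite far_line.
- by rewrite hcoX subrr.
Qed.

Lemma top_wf v h s : wfv v -> region v h ->
  let: (v', g) := top v h s in
  [/\ wfv v', miss v' = line_idx (miss v) (~~ s) &
    forall u p, u != 0 -> p != 0 -> region v' (hmid s g u p)].
Proof.
elim: v h s => [|v IHv s0 h0|v IHv h0 u0] h s wf R.
- rewrite top_far //; split=> // [|u p u0 p0]; first by rewrite /= hcoX subrr.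
  exact: region_midV.
- have [F|F] := boolP (far (VLine v s0 h0) h s).
    rewrite top_far //; split=> // [|u p u0 p0]; last exact: region_midV.
    exact: wf_top_far.
  move/negPf in F; have [E q0] := near_VLine F; have r0 := region_right R F.
  case/and4P: wf => wf R0 F0 /eqP h00; rewrite top_nearV //; split.
  + by apply/and3P; split=> //; apply: region_line.
  + by rewrite /= E negbK line_idxK.
  + by move=> u p u0 p0; apply: region_midE.
have [F|F] := boolP (far (VEdge v h0 u0) h s).
  rewrite top_far //; split=> // [|u p un0 p0]; last exact: region_midV.
  exact: wf_top_far.
move/negPf in F; have r0 := region_right R F.
have q0 : hco (~~ s) h != 0 by rewrite /= in F; rewrite F.
have p0 := region_left R q0.
case/and3P: wf => wf R0 u0n0; rewrite (top_nearE F).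
have := IHv h0 s wf R0; case: (top v h0 s) => v' g [wf' m' R']; split=> //.
- by apply/and3P; split=> //; apply: R'.
- by move=> u p un0 pn0; apply: region_midE.
Qed.

Lemma hX_split t a : hX t a = hX t a ⋅ hX (~~ t) 0.
Proof. by rewrite hmulX0. Qed.

Lemma chart_wf v h : wfv v -> wfc (chart v h).
Proof.
case: v => [//|v s0 h0|v h0 u] wf.
  case/and4P: (wf) => wf0 R0 F0 /eqP h00.
  have [[a [c ->]]|R] := heisV_case s0 h; last first.
    by rewrite chart_region //; apply/andP.
  rewrite chart_VLine; case: eqP => [_|/eqP c0].
    by apply/andP; split=> //; apply: region_line.
  by apply/and3P; split=> //; apply: region_line.
case/and3P: (wf) => wf0 R0 u0.
case: (heisE_case h) => [->|[s [a [c [a0 ->]]]]|R]; first exact/and3P.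
  rewrite chart_VEdge // /chartE; have := top_wf s wf0 R0.
  case: (top v h0 s) => v' g [wf' _ R']; case: eqP => [_|/eqP c0].
    by apply/andP; split=> //; apply: R'.
  by apply/and3P; split=> //; apply: R'.
by rewrite chart_region //; apply/andP.
Qed.

(** * The action in charts *)

Lemma act_CRoot v h s a : act (line_idx (miss v) s) a (CRoot v h) = chart v (h ⋅ hX s a).
Proof. by rewrite /act idx_posE. Qed.

Lemma act_CRoot_miss v h a : act (miss v) a (CRoot v h) =
  if a == 0 then CRoot v h else CNext v h a.
Proof. by rewrite /act idx_pos_refl. Qed.

Lemma act_CNext_miss v h u a : act (miss v) a (CNext v h u) =
  if u + a == 0 then CRoot v h else CNext v h (u + a).
Proof. by rewrite /act idx_pos_refl. Qed.

Lemma act_CNext v h u s a : act (line_idx (miss v) s) a (CNext v h u) =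
  if a == 0 then CNext v h u else
  let: (v', g) := top v h s in CRoot v' (hmid s g u a).
Proof. by rewrite /act idx_posE. Qed.

Lemma bool_case (s s' : bool) : s = s' \/ s = ~~ s'.
Proof. by case: s s' => -[]; [left|right|right|left]. Qed.

Lemma act_chart_VLine v s0 h0 h s a : wfv (VLine v s0 h0) ->
  act (line_idx (miss (VLine v s0 h0)) s) a (chart (VLine v s0 h0) h) =
  chart (VLine v s0 h0) (h ⋅ hX s a).
Proof.
move=> wf; case/and4P: (wf) => wf0 R0 F0 /eqP h00.
have [[b [c ->]]|R] := heisV_case s0 h; last first.
  by rewrite chart_region // act_CRoot.
have [->|->] := bool_case s s0.
  rewrite hmulXD !chart_VLine [miss _]/= line_idxK.
  have [->|c0] := eqVneq c 0; last by rewrite act_CNext_miss.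
  by rewrite act_CRoot_miss add0r.
rewrite chart_VLine [miss _]/= line_idxN.
have [->|c0] := eqVneq c 0.
  rewrite hmulX0 hXD act_CRoot hmulXD -[hX (~~ s0) _](hmulX0 _ s0).
  by rewrite chart_VLine eqxx chart_region //; apply: region_line.
rewrite act_CNext top_line //; have [->|a0] := eqVneq a 0.
  by rewrite hmulX0 chart_VLine (negPf c0).
by rewrite -/(hmid s0 b c a) chart_region //; apply: region_midV.
Qed.

(** A chamber X_s'(b) X_(~~ s')(c) with nonzero b is viewed from the other end of the panel of type
    s'. Type ~~ s' changes c; type s' changes b when c = 0, and otherwise leads into the region. *)
Lemma act_chart_VEdge v h0 u h s a : wfv (VEdge v h0 u) ->
  act (line_idx (miss (VEdge v h0 u)) s) a (chart (VEdge v h0 u) h) =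
  chart (VEdge v h0 u) (h ⋅ hX s a).
Proof.
move=> wf; case/and3P: (wf) => wf0 R0 u0.
case: (heisE_case h) => [->|[s' [b [c [b0 ->]]]]|R]; last first.
- by rewrite chart_region // act_CRoot.
- have := top_mid s' wf0 R0 u0 b0.
  have := top_wf s' wf0 R0; have := chart_top s' wf0 R0.
  have Etop b' c' : chartE v h0 u s' b' c' = let: (v', g) := top v h0 s' in
    if c' == 0 then CRoot v' (hmid s' g u b') else CNext v' (hmid s' g u b') c'.
    by [].
  rewrite chart_VEdge // [miss _]/= Etop.
  case: (top v h0 s') Etop => v1 g Etop [_ T1] [wf1 m1 R1] T2.
  have [->|->] := bool_case s s'; last first.
    rewrite hmulXD chart_VEdge // Etop -m1.
    have [->|c0] := eqVneq c 0; last by rewrite act_CNext_miss.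
    by rewrite act_CRoot_miss add0r.
  rewrite -line_idxN -m1; have [->|c0] := eqVneq c 0.
    rewrite act_CRoot hmulX0 hXD hmulXD.
    have [->|ba0] := eqVneq (b + a) 0.
      by rewrite !hX0 hmul1 T1.
    rewrite -/(hmid s' g u (b + a)) [hX s' (b + a)]hX_split chart_VEdge // Etop eqxx.
    by rewrite chart_region //; apply: R1.
  rewrite act_CNext; have [->|a0] := eqVneq a 0.
    by rewrite hmulX0 chart_VEdge // Etop (negPf c0).
  rewrite T2 chart_region /hmid ?negbK //.
  by have := @region_midE v h0 u (~~ s') b c a b0 c0 a0; rewrite /hmid negbK.
have [->|a0] := eqVneq a 0; first by rewrite hmulX0 chart_VEdge1 [miss _]/= act_CNext eqxx.
rewrite chart_VEdge1 [miss _]/= act_CNext (negPf a0).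
by rewrite hmul1g [hX s a]hX_split chart_VEdge // /chartE eqxx.
Qed.

(** Root groups act by right translations in every chart of a vertex they belong to, so the
    relations become identities in the Heisenberg group. *)
Lemma act_chart v h s a : wfv v ->
  act (line_idx (miss v) s) a (chart v h) = chart v (h ⋅ hX s a).
Proof.
case: v => [|v s0 h0|v h0 u]; last exact: act_chart_VEdge.
  by move=> _; rewrite act_CRoot.
exact: act_chart_VLine.
Qed.

Lemma idx_cases (m k : 'I_3) : k = m \/ exists s, k = line_idx m s.
Proof.
by case: (ord3S_case m k) => ->; [left|right; exists false|right; exists true].
Qed.

(** Every chamber has a vertex of each type: its lowest vertex or, for [CNext], its top vertex,
    together with the other ends of its two panels. *)
Lemma chart_cover c k : wfc c -> exists v h, [/\ wfv v, miss v = k & c = chart v h].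
Proof.
case: c => [v h /andP[wf R]|v h u /and3P[wf R u0]].
  have [->|[s ->]] := idx_cases (miss v) k.
    by exists v, h; split=> //; rewrite chart_region.
  have := top_wf (~~ s) wf R; have := chart_top (~~ s) wf R.
  case: (top v h (~~ s)) => v' g [T _] [wf' m' _].
  by exists v', (hX (~~ ~~ s) g); split; rewrite // m' negbK.
have [->|[s ->]] := idx_cases (miss v) k.
  by exists (VEdge v h u), (0, 0, 0); split=> //; apply/and3P.
have := top_wf (~~ s) wf R; have := chart_top (~~ s) wf R.
case: (top v h (~~ s)) => v' g [_ T] [wf' m' _].
by exists v', (hX (~~ ~~ s) g ⋅ hX (~~ s) u); split; rewrite ?T // m' negbK.
Qed.

Lemma chart_cover_line c i : wfc c ->
  exists v h s, [/\ wfv v, i = line_idx (miss v) s & c = chart v h].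
Proof.
move=> /(@chart_cover _ (ord3S i)) [v [h [wf m ->]]].
by exists v, h, true; rewrite m /line_idx ord3S3.
Qed.

Lemma act_wf i a c : wfc c -> wfc (act i a c).
Proof.
move=> /(chart_cover_line i) [v [h [s [wf -> ->]]]].
by rewrite act_chart //; apply: chart_wf.
Qed.

Lemma act0 i c : wfc c -> act i 0 c = c.
Proof.
move=> /(chart_cover_line i) [v [h [s [wf -> ->]]]].
by rewrite act_chart // hmulX0.
Qed.

Lemma actD i a b c : wfc c -> act i (a + b) c = act i b (act i a c).
Proof.
move=> /(chart_cover_line i) [v [h [s [wf -> ->]]]].
by rewrite !act_chart // hmulXD.
Qed.

Lemma line_idx_pair i j : i != j -> exists m s, i = line_idx m s /\ j = line_idx m (~~ s).
Proof.
move=> ij; case: (ord3S_case i j) ij => ->; first by rewrite eqxx.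
  by exists (ord3S (ord3S i)), false; rewrite /line_idx /= !ord3S3.
by exists (ord3S i), true; rewrite /line_idx /= !ord3S3.
Qed.


End Chambers.

(** * The action on chambers and the free product *)

Section GroupAction.
Local Open Scope classical_set_scope.
Local Open Scope group_scope.

Local Notation "g ⋅ h" := (hmul g h) (at level 40, left associativity).
Local Notation Qfam := (fun _ : 'I_3 => Qadd).

Definition act_word (w : seq {i : 'I_3 & Qadd}) (c : chamber) : chamber :=
  foldl (fun c (t : {i : 'I_3 & Qadd}) => act (tag t) (tagged t) c) c w.

Lemma act_word_wf w c : wfc c -> wfc (act_word w c).
Proof. by elim: w c => //= t w IHw c wf; apply/IHw/act_wf. Qed.

Lemma act_word_eq v w : @word_eq _ Qfam v w ->
  forall c, wfc c -> act_word v c = act_word w c.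
Proof.
elim=> {v w} //.
- by move=> v w _ IH c wf; rewrite IH.
- by move=> u v w _ IH1 _ IH2 c wf; rewrite IH1 ?IH2.
- move=> v v' w w' _ IH1 _ IH2 c wf.
  by rewrite /act_word !foldl_cat -!/(act_word _ _) IH1 // IH2 //; apply: act_word_wf.
- by move=> i c wf; apply: act0.
- by move=> i a b c wf; rewrite /act_word /= -actD.
Qed.

Definition copies_act (x : U_copies) (c : chamber) : chamber := act_word (repr x) c.

Lemma copies_act_word w c : wfc c ->
  copies_act (fp_word (w : seq {i : 'I_3 & Qfam i})) c = act_word w c.
Proof. by move=> wf; apply: act_word_eq => //; apply/fp_word_eq/fp_wordK. Qed.

Lemma copies_actM x y c : wfc c ->
  copies_act (x * y) c = copies_act y (copies_act x c).
Proof.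
move=> wf; rewrite {1}/copies_act -/(copies_act (x * y) c).
rewrite -{1}[x]fp_wordK -{1}[y]fp_wordK.
have -> : (fp_word (repr x) : U_copies) * fp_word (repr y) = fp_word (repr x ++ repr y).
  exact/esym/fp_wordM.
by rewrite copies_act_word // /act_word foldl_cat.
Qed.

Lemma copies_act1 c : wfc c -> copies_act 1 c = c.
Proof. exact: copies_act_word [::] c. Qed.

Lemma copies_act_wf x c : wfc c -> wfc (copies_act x c).
Proof. exact: act_word_wf. Qed.

Lemma copies_actV x c d : wfc c -> wfc d -> copies_act x c = d -> copies_act x^-1 d = c.
Proof. by move=> wc wd <-; rewrite -copies_actM // mulgV copies_act1. Qed.

Lemma copies_act_inj i (a : rat) c : wfc c -> copies_act (fp_inj Qfam i a) c = act i a c.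
Proof. by move=> wf; rewrite /fp_inj copies_act_word. Qed.

Lemma copies_act_injV i (a : rat) c : wfc c ->
  copies_act (fp_inj Qfam i a)^-1 c = act i (- a)%R c.
Proof.
move=> wf; apply: copies_actV => //; first exact: act_wf.
by rewrite copies_act_inj ?act_wf // -actD // addNr act0.
Qed.

Definition acts_central m (z : rat) (y : U_copies) :=
  forall v h, wfv v -> miss v = m ->
    copies_act y (chart v h) = chart v (h ⋅ (0, 0, z)%R).

Lemma hmul_comm s (h : heis) (b c : rat) :
  h ⋅ hX s (- b)%R ⋅ hX (~~ s) (- c)%R ⋅ hX s b ⋅ hX (~~ s) c =
  h ⋅ (0, 0, hsg s * b * c)%R.
Proof.
by case: h s => -[x y] z []; rewrite /hmul /hX /hsg /=; congr (_, _, _); field.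
Qed.

Lemma acts_central_comm v s (b c : rat) h : wfv v ->
  copies_act [~ fp_inj Qfam (line_idx (miss v) s) b,
     fp_inj Qfam (line_idx (miss v) (~~ s)) c] (chart v h) =
  chart v (h ⋅ (0, 0, hsg s * b * c)%R).
Proof.
move=> wf; have W h' : wfc (chart v h') by apply: chart_wf.
rewrite /commg /conjg !copies_actM ?copies_act_injV ?copies_act_inj;
  do ?[exact: W | apply: copies_act_wf | apply: act_wf].
by rewrite !act_chart // hmul_comm.
Qed.

(** At the vertices missing the third index, [U_i, U_j] acts by central translations and U_i by
    translations, so they commute there; the charts at these vertices cover all chambers. *)
Lemma relators_act_trivial u : U_relators u -> forall c, wfc c -> copies_act u c = c.
Proof.
move=> [[i j] /= ij]; have [m [s [Ei Ej]]] := line_idx_pair ij.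
move: u; apply: generated_sub.
  split=> [|x y Kx Ky c wc]; first exact: copies_act1.
  by rewrite copies_actM // Kx //; apply: copies_actV => //; apply: Ky.
move=> _ [_ [a _ <-] [y Cy <-]] c wc.
have [z zy] : exists z, acts_central m z y.
  move: y Cy; apply: generated_sub.
    split=> [|x y [z Hz] [z' Hz']].
      exists 0%R => v h wf mv; rewrite copies_act1 ?chart_wf //.
      by rewrite (_ : (0, 0, 0)%R = (0, 0, 0)%R :> heis) // hmul1.
    exists (z - z')%R => v h wf mv.
    rewrite copies_actM ?chart_wf // Hz //; apply: copies_actV; rewrite ?chart_wf //.
    rewrite Hz' //; congr (chart v _); case: (h) => -[p q] r.
    by rewrite /hmul /=; congr (_, _, _); ring.
  move=> _ [_ [b _ <-] [_ [d _ <-] <-]]; exists (hsg s * (b : rat) * (d : rat))%R.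
  by move=> v h wf mv; rewrite Ei Ej -mv acts_central_comm.
have [v [h [wf mv ->]]] := chart_cover m wc.
have W h' : wfc (chart v h') by apply: chart_wf.
have zyV h' : copies_act y^-1 (chart v h') = chart v (h' ⋅ (0, 0, - z)%R).
  apply: copies_actV; rewrite ?W // zy //; congr (chart v _); case: (h') => -[p q] r.
  by rewrite /hmul /=; congr (_, _, _); ring.
rewrite /commg /conjg !copies_actM; do ?[exact: W | apply: copies_act_wf].
rewrite copies_act_injV ?W // Ei -mv act_chart // zyV copies_act_inj ?W //.
rewrite act_chart // zy //; congr (chart v _).
by case: (h) (s) => -[p q] r []; rewrite /hmul /hX /=; congr (_, _, _); field.
Qed.

Lemma normal_closure_act x : normal_closure U_relators x ->
  forall c, wfc c -> copies_act x c = c.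
Proof.
move=> Nx; apply: (Nx [set u | forall c, wfc c -> copies_act u c = c]).
split; last by move=> u; apply: relators_act_trivial.
split; first split=> [|u v Ku Kv c wc]; first exact: copies_act1.
  by rewrite copies_actM // Ku //; apply: copies_actV => //; apply: Kv.
move=> u v Ku c wc; rewrite /conjg !copies_actM ?copies_act_wf //.
rewrite Ku ?copies_act_wf //.
by rewrite -copies_actM // mulVg copies_act1.
Qed.

Definition gact (g : U_A2t) (c : chamber) : chamber := copies_act (repr g) c.

Lemma gact_map x c : wfc c ->
  gact (quotient_map (normal_closure_group U_relators) x) c = copies_act x c.
Proof.
move=> wc; rewrite /gact; set y := repr _.
have := repr_quotient_map (normal_closure_group U_relators) x; rewrite -/y => N.
rewrite -[x](mulVKg y) copies_actM //; apply/esym/(normal_closure_act N).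
exact: copies_act_wf.
Qed.

Lemma gactM g h c : wfc c -> gact (g * h) c = gact h (gact g c).
Proof.
move=> wc; rewrite -{1}[g]quotient_mapK -{1}[h]quotient_mapK -[_ * _]quotient_mapM.
by rewrite gact_map // copies_actM.
Qed.

Lemma gact1 c : wfc c -> gact 1 c = c.
Proof. by move=> wc; rewrite [LHS]gact_map // copies_act1. Qed.

Lemma gact_xgen i (a : rat) c : wfc c -> gact (xgen i a) c = act i a c.
Proof. by move=> wc; rewrite gact_map // copies_act_inj. Qed.

(* [zidx b] and its successor are the indices of the two root groups whose
   commutator is Z_12 (b = false) or Z_23 (b = true). *)
Definition zidx (b : bool) : 'I_3 := if b then ord3S 0%R else 0%R.

Definition zgen (b : bool) (a : Qadd) : U_A2t :=
  [~ xgen (zidx b) (1 : rat)%R, xgen (ord3S (zidx b)) a].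

Lemma xgen_comm_comm i j (a b c : rat) : i != j ->
  commute (xgen i c) [~ xgen i a, xgen j b] /\ commute (xgen j c) [~ xgen i a, xgen j b].
Proof.
move=> ij; split; first by apply/commgP/eqP/xgen_rel.
by rewrite -invgR; apply: commuteV; apply/commgP/eqP/xgen_rel; rewrite eq_sym.
Qed.

Lemma xgen_commDl i j (a a' b : rat) : i != j ->
  [~ xgen i (a + a')%R, xgen j b] = [~ xgen i a, xgen j b] * [~ xgen i a', xgen j b].
Proof.
move=> ij; rewrite xgenD commMgJ; congr (_ * _); apply/conjg_fixP/commgP.
exact/commute_sym/(xgen_comm_comm _ _ _ ij).1.
Qed.

Lemma xgen_commDr i j (a b b' : rat) : i != j ->
  [~ xgen i a, xgen j (b + b')%R] = [~ xgen i a, xgen j b] * [~ xgen i a, xgen j b'].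
Proof.
move=> ij; rewrite addrC xgenD commgMJ; congr (_ * _); apply/conjg_fixP/commgP.
exact/commute_sym/(xgen_comm_comm _ _ _ ij).2.
Qed.

Lemma zidx_neq b : zidx b != ord3S (zidx b).
Proof. by rewrite eq_sym ord3S_neq. Qed.

Lemma zgenM b : {morph zgen b : x y / x * y}.
Proof. by move=> x y; apply: (xgen_commDr _ _ _ (zidx_neq b)). Qed.

Lemma zgenF b : {morph zgen b : x y / x / y}.
Proof.
move=> x y; rewrite zgenM; congr (_ * _); apply/esym/mulg1_eq.
by rewrite -zgenM mulgV /zgen (_ : xgen _ (1 : Qadd) = 1) ?commg1 //; apply: xgen0.
Qed.

HB.instance Definition _ b := isGroupMorphism.Build Qadd U_A2t (zgen b) (zgenF b).

(** The commutator is biadditive on Q because it is central in the vertex group, so fixing the first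
    argument in [zgen] still reaches all of it. *)
Lemma xgen_comm_zgen b (x y : rat) :
  [~ xgen (zidx b) x, xgen (ord3S (zidx b)) y] = zgen b (x * y)%R.
Proof.
apply: (@biadditive_rat _ (fun x y => [~ xgen (zidx b) x, xgen (ord3S (zidx b)) y])).
  by move=> *; apply/xgen_commDl/zidx_neq.
by move=> *; apply/xgen_commDr/zidx_neq.
Qed.

Definition zmiss b : 'I_3 := ord3S (ord3S (zidx b)).

Lemma gact_zgen b (a : rat) v h : wfv v -> miss v = zmiss b ->
  gact (zgen b a) (chart v h) = chart v (h ⋅ (0, 0, a)%R).
Proof.
move=> wf mv; have W h' : wfc (chart v h') by apply: chart_wf.
have Ei : zidx b = line_idx (miss v) false by rewrite mv /= ord3S3.
have Ej : ord3S (zidx b) = line_idx (miss v) true by rewrite mv /= ord3S3.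
rewrite /zgen /commg /conjg -!xgenN !gactM;
  do ?[exact: W | apply: copies_act_wf].
rewrite !gact_xgen; do ?[exact: W | apply: act_wf | rewrite gact_xgen].
rewrite Ej Ei !act_chart //.
by rewrite (hmul_comm false) /= !mul1r.
Qed.

Lemma region_center v (z : rat) : z != 0%R -> region v (0, 0, z)%R.
Proof.
move=> z0; have H s : ~~ hprod s (0, 0, z)%R.
  by rewrite /hprod; case: s => /=; rewrite !(mulr0, mul0r).
by case: v => //= *; rewrite !H.
Qed.

(** A central coordinate makes the U_2 panel far, so its other end is a new [VLine]. There the
    chamber has coordinate 0, and Z_b moves it into the region of that new vertex. *)
Lemma zgen_step v (z a : rat) b : wfv v -> region v (0, 0, z)%R ->
  miss v = zmiss (~~ b) -> a != 0%R ->
  let v' := VLine v b (0, 0, z)%R in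
  [/\ wfv v', miss v' = zmiss b &
    gact (zgen b a) (CRoot v (0, 0, z)%R) = CRoot v' (0, 0, a)%R].
Proof.
move=> wf R mv a0 v'.
have wf' : wfv v'.
  apply/and4P; split=> //; last by case: (b).
  by case: (v) => //= *; rewrite ?orbF; case: (b); rewrite /= eqxx ?orbT.
have mv' : miss v' = zmiss b by rewrite /= mv; case: (b); apply: val_inj.
split=> //.
have -> : CRoot v (0, 0, z)%R = chart v' (0, 0, 0)%R.
  have := chart_VLine v b (0, 0, z)%R 0%R 0%R.
  by rewrite !hX0 !hmul1 eqxx => ->.
by rewrite gact_zgen // hmul1g chart_region //; apply: region_center.
Qed.

(** * Alternating words and the embedding of the free product *)

Local Notation Zfam := (fun _ : bool => Qadd).
Local Notation zletter := {b : bool & Qadd}.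

Definition zreduced (w : seq zletter) :=
  sorted (fun t u : zletter => tag t != tag u) w &&
  all (fun t : zletter => tagged t != 0%R :> rat) w.

Definition zword (w : seq zletter) : U_A2t := \prod_(t <- w) zgen (tag t) (tagged t).

Lemma zword_path t w v (z : rat) : wfv v -> z != 0%R -> miss v = zmiss (tag t) ->
  path (fun t u : zletter => tag t != tag u) t w ->
  all (fun t : zletter => tagged t != 0%R :> rat) w ->
  exists v' (z' : rat), z' != 0%R /\
    gact (zword w) (CRoot v (0, 0, z)%R) = CRoot v' (0, 0, z')%R.
Proof.
elim: w t v z => [|u w IHw] t v z wf z0 mv /=.
  move=> _ _; exists v, z; split=> //; rewrite /zword big_nil gact1 //.
  by apply/andP; split=> //; apply: region_center.
move=> /andP[tu pw] /andP[u0 aw].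
have mv' : miss v = zmiss (~~ tag u) by rewrite mv; case: (tag t) (tag u) tu => -[].
have [wf' m' E] := zgen_step wf (region_center v z0) mv' u0.
rewrite /zword big_cons gactM; last by apply/andP; split=> //; apply: region_center.
by rewrite E; apply: (IHw u).
Qed.

Definition base_chamber := CRoot Root (0, 0, 0)%R.

Lemma zword_neq1 w : zreduced w -> w != [::] -> zword w <> 1.
Proof.
case: w => // t w /andP[/= pw /andP[t0 aw]] _ E.
have wb : wfc base_chamber by [].
have : gact (zword (t :: w)) base_chamber = base_chamber by rewrite E gact1.
rewrite /zword big_cons gactM //.
have [v [wf mv ->]] : exists v, [/\ wfv v, miss v = zmiss (tag t) &
    gact (zgen (tag t) (tagged t)) base_chamber = CRoot v (0, 0, tagged t)%R].
  (* The root vertex belongs to U_1 and U_2, so an initial letter of Z_12 acts in its own chart. For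
     Z_23 one step outward is taken, with z = 0, which the region of [Root] allows. *)
  case Et: (tag t); last first.
    exists Root; split=> //; rewrite -[base_chamber]/(chart Root (0, 0, 0)%R).
    by rewrite gact_zgen // hmul1g.
  have [wf m H] := @zgen_step Root 0%R (tagged t) true isT isT erefl t0.
  by exists (VLine Root true (0, 0, 0)%R).
have [v' [z' [z0 ->]]] := zword_path wf t0 mv pw aw.
by case=> _ z'0; rewrite z'0 eqxx in z0.
Qed.

Lemma zreduce (w : seq zletter) : exists2 w', @word_eq _ Zfam w w' & zreduced w'.
Proof.
elim: w => [|t w [w' ww' rw']]; first by exists [::] => //; apply: WordRefl.
have tw : @word_eq _ Zfam (t :: w) (t :: w').
  exact: (@WordCat _ Zfam [:: t] [:: t] w w' (WordRefl _) ww').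
have [t0|t0] := eqVneq (tagged t : rat) 0%R.
  exists w' => //; apply: WordTrans tw _.
  apply: (@WordCat _ Zfam [:: t] [::] w' w' _ (WordRefl _)).
  by case: t t0 => i a /= ->; apply: (@WordOne _ Zfam i).
case: w' rw' ww' tw => [|u w'] rw' ww' tw.
  by exists [:: t] => //; rewrite /zreduced /= t0.
have [tu|tu] := eqVneq (tag t) (tag u); last first.
  exists (t :: u :: w') => //; case/andP: rw' => pw aw.
  by rewrite /zreduced /= tu t0; apply/andP; split.
have rw : zreduced w'.
  case/andP: rw' => /= pw /andP[_ aw]; apply/andP; split=> //.
  exact: path_sorted pw.
pose v : zletter := @letter _ Zfam (tag t) (tagged t * tagged u).
have tuv : @word_eq _ Zfam (t :: u :: w') (v :: w').
  apply: (@WordCat _ Zfam [:: t; u] [:: v] w' w' _ (WordRefl _)).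
  rewrite /v; case: t u tu {tw rw' ww' t0 v} => i a [j b] /= <-.
  exact: (@WordMul _ Zfam).
have [v0|v0] := eqVneq (tagged v : rat) 0%R.
  exists w' => //; apply: WordTrans tw _; apply: WordTrans tuv _.
  apply: (@WordCat _ Zfam [:: v] [::] w' w' _ (WordRefl _)).
  rewrite (_ : v = @letter _ Zfam (tag t) 1); first exact: (@WordOne _ Zfam).
  by rewrite /v; congr letter.
exists (v :: w'); first by apply: WordTrans tw _.
case/andP: rw' => /= pw /andP[_ aw]; rewrite /zreduced /= v0 aw !andbT.
by case: w' pw {aw rw tw tuv ww'} => //= x w' /andP[ux ->]; rewrite tu ux.
Qed.

Definition zfree : Q_free_Q -> U_A2t :=
  fp_lift (fun b => zgen b : UMagmaMorphism.type Qadd U_A2t).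

HB.instance Definition _ := UMagmaMorphism.on zfree.

Lemma zfree_word w : zfree (fp_word (w : seq {b : bool & Zfam b})) = zword w.
Proof. exact: fp_lift_word. Qed.

Lemma zfree_inj : injective zfree.
Proof.
apply: gmulf_inj => x; rewrite -[x]fp_wordK.
have [w /fp_word_eq -> rw] := zreduce (repr x).
have [-> //|w0] := eqVneq w [::].
by move=> E; case: (zword_neq1 rw w0); rewrite -E; apply/esym/zfree_word.
Qed.

End GroupAction.

(** * Images under phi *)

Section Conclusion.
Local Open Scope classical_set_scope.
Local Open Scope group_scope.

(** As [isomorphic] asks for a map on all of G, the inverse of f is extended by 1 outside the
    range. *)
Lemma isomorphic_range (G H : groupType) (f : UMagmaMorphism.type H G) (A : set G) :
  injective f -> range f = A -> isomorphic A [set: H].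
Proof.
move=> f_inj <-.
have /choice[g gP] : forall y : G, exists x : H, range f y -> f x = y.
  move=> y; have [[x _ <-]|ny] := pselect (range f y); first by exists x.
  by exists 1.
have gK x : g (f x) = x by apply: f_inj; apply: gP; exists x.
exists g; last by move=> _ _ [x _ <-] [y _ <-]; rewrite -gmulfM !gK.
split=> //.
- by move=> _ _ /set_mem[x _ <-] /set_mem[y _ <-]; rewrite !gK => ->.
- by move=> x _; exists (f x); [exists x | rewrite gK].
Qed.

Lemma range_subgroup (G H : groupType) (f : UMagmaMorphism.type H G) :
  is_subgroup (range f).
Proof.
split=> [|_ _ [x _ <-] [y _ <-]]; first by exists 1; rewrite ?gmulf1.
by exists (x / y); rewrite ?gmulfF.
Qed.

Lemma range_zgen b : range (zgen b) = commutator (Usub (zidx b)) (Usub (ord3S (zidx b))).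
Proof.
apply/seteqP; split=> [_ [a _ <-]|].
  apply: sub_generated; exists (xgen (zidx b) (1 : rat)%R); first by exists (1 : rat)%R.
  by exists (xgen (ord3S (zidx b)) a) => //; exists a.
apply: generated_sub; first exact: (range_subgroup (zgen b)).
move=> _ [_ [a _ <-] [_ [c _ <-] <-]].
by exists ((a : rat) * (c : rat))%R => //; rewrite -xgen_comm_zgen.
Qed.

Lemma U1E : U1 = Usub (zidx false).
Proof. by congr Usub; apply: val_inj. Qed.
Lemma U2E b : U2 = Usub (if b then zidx true else ord3S (zidx false)).
Proof. by congr Usub; case: b; apply: val_inj. Qed.
Lemma U3E : U3 = Usub (ord3S (zidx true)).
Proof. by congr Usub; apply: val_inj. Qed.

Lemma commutator12E : commutator U1 U2 = range (zgen false).
Proof. by rewrite range_zgen U1E (U2E false). Qed.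
Lemma commutator23E : commutator U2 U3 = range (zgen true).
Proof. by rewrite range_zgen U3E (U2E true). Qed.

Lemma zgen_inj b : injective (zgen b).
Proof.
apply: gmulf_inj => a za; apply: contrapT => a0.
have := @zword_neq1 [:: @letter _ (fun _ : bool => Qadd) b a].
rewrite /zreduced /zword /= big_seq1 za; apply=> //.
by rewrite andbT; apply/eqP.
Qed.

Lemma range_zfree : range zfree = U12_23.
Proof.
have zU b a : U12_23 (zgen b a).
  apply: sub_generated; case: b; [right|left].
    by rewrite commutator23E; exists a.
  by rewrite commutator12E; exists a.
have sU : is_subgroup U12_23 by apply: generated_subgroup.
have inj_zfree b a : zfree (fp_inj (fun=> Qadd) b a) = zgen b a by exact: fp_lift_inj.
apply/seteqP; split=> [_ [x _ <-]|].
  rewrite -[x]fp_wordK zfree_word /zword.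
  elim: (repr x) => [|t w IHw].
    by rewrite big_nil; exact: sU.1.
  by rewrite big_cons; exact: (subgroupM sU (zU _ _) IHw).
apply: generated_sub; first exact: (range_subgroup zfree).
move=> x []; rewrite ?commutator12E ?commutator23E => -[a _ <-].
  by exists (fp_inj (fun=> Qadd) false a).
by exists (fp_inj (fun=> Qadd) true a).
Qed.

(** * The image under phi *)

Local Open Scope ring_scope.

(** Z_12 maps to entry (1,3), Z_23 to entry (2,1) and their commutators to entry (2,3): a Heisenberg
    group for the basis order 2, 1, 3. *)
Definition heis_loop_mx (a b c : rat) : 'M[{poly rat}]_3 :=
  mx3 [:: [:: 1; 0; a%:P]; [:: b *: 'X; 1; c *: 'X]; [:: 0; 0; 1]].

Lemma heis_loop_mxM a b c a' b' c' :
  heis_loop_mx a b c *m heis_loop_mx a' b' c' =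
  heis_loop_mx (a + a') (b + b') (c + c' + b * a').
Proof.
rewrite mx3M; do ![congr (mx3 _) | congr (_ :: _)];
  rewrite -?mul_polyC ?polyCD ?polyCM; ring.
Qed.

Lemma phi_zgen b (x : rat) : SLval (phi (zgen b x)) =
  if b then heis_loop_mx 0 x 0 else heis_loop_mx x 0 0.
Proof.
rewrite /zgen /commg /conjg -!xgenN !gmulfM /= !phi_xgen.
case: b; rewrite /phi_mx /= !mx3M;
  do ![congr (mx3 _) | congr (_ :: _)]; rewrite -?mul_polyC ?polyC0 ?polyC1 ?polyCN; ring.
Qed.

Lemma heis_mx_det (a b c : rat) :
  \det (mx3 [:: [:: 1; b; c]; [:: 0; 1; a]; [:: 0; 0; 1]] : 'M[rat]_3) == 1.
Proof.
apply/eqP; rewrite -det_tr det_trig; last first.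
  by apply/is_trig_mxP => -[[|[|[|//]]] ?] [[|[|[|//]]] ?]; rewrite !mxE.
by rewrite !big_ord_recl big_ord0 !mxE /= !mulr1.
Qed.

(** On the matrices [heis_loop_mx], this swaps the first two basis vectors and sets X = 1. *)
Definition heis_of_loop (M : SL {poly rat} 3) : SL rat 3 :=
  MkSL (heis_mx_det (M 0 (inord 2))`_0 (M (inord 1) 0)`_1 (M (inord 1) (inord 2))`_1).

Lemma heis_of_loopE M a b c : SLval M = heis_loop_mx a b c ->
  SLval (heis_of_loop M) = mx3 [:: [:: 1; b; c]; [:: 0; 1; a]; [:: 0; 0; 1]].
Proof.
move=> E; rewrite /heis_of_loop /= E !mxE /= !inordK //=.
by rewrite !coefZ !coefX !coefC /= !mulr1.
Qed.

Lemma phi_mulE g h A B : SLval (phi g) = A -> SLval (phi h) = B ->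
  SLval (phi (g * h)%g) = A *m B.
Proof. by move=> <- <-; rewrite gmulfM. Qed.

Lemma heis_loop_lift a b c :
  exists2 g, U12_23 g & SLval (phi g) = heis_loop_mx a b c.
Proof.
(* The first two factors produce a and b with third parameter b a; the other four form a commutator
   contributing the missing d to the centre. *)
pose d := c - b * a.
exists (zgen true b * zgen false a * (zgen true d * zgen false 1%R *
  (zgen true (- d) * zgen false (- 1))))%g.
  have sR := range_subgroup (zfree : UMagmaMorphism.type _ _).
  have zR e (x : rat) : range zfree (zgen e x).
    by exists (fp_inj (fun=> Qadd) e x) => //; exact: fp_lift_inj.
  rewrite -range_zfree.
  have M := subgroupM sR.
  by apply: (M _ _ (M _ _ _ _) (M _ _ (M _ _ _ _) (M _ _ _ _))).
rewrite (phi_mulE (phi_mulE (phi_zgen _ _) (phi_zgen _ _))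
  (phi_mulE (phi_mulE (phi_zgen _ _) (phi_zgen _ _))
    (phi_mulE (phi_zgen _ _) (phi_zgen _ _)))).
by rewrite !heis_loop_mxM /d; congr heis_loop_mx; ring.
Qed.

Lemma phi_U12_23 : phi @` U12_23 = [set M | exists a b c, SLval M = heis_loop_mx a b c].
Proof.
apply/seteqP; split=> [_ [y + <-]|M [a [b [c E]]]]; last first.
  have [g Ug Eg] := heis_loop_lift a b c; exists g => //.
  by apply: val_inj; rewrite /= Eg.
rewrite -range_zfree => -[x _ <-]; rewrite -[x]fp_wordK zfree_word /zword.
elim: (repr x) => [|t w [a [b [c E]]]].
  rewrite big_nil gmulf1; exists 0, 0, 0; rewrite /= mx3_1 /heis_loop_mx.
  by rewrite !scale0r polyC0.
rewrite big_cons gmulfM /= E phi_zgen.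
by case: (tag t); rewrite heis_loop_mxM; do 3!eexists.
Qed.

Lemma heisenbergE (A : SL rat 3) : heisenberg A <->
  SLval A = mx3 [:: [:: 1; A 0 (inord 1); A 0 (inord 2)];
                    [:: 0; 1; A (inord 1) (inord 2)]; [:: 0; 0; 1]].
Proof.
split=> [hA|E i j ji]; last first.
  by rewrite E mxE; case: i j ji => -[|[|[|//]]] ? [[|[|[|//]]] ?].
apply/matrixP => i j; rewrite mxE.
have [ji|ij] := leqP j i.
  rewrite hA //; case: i j ji => -[|[|[|//]]] ? [[|[|[|//]]] ?] //=.
have -> : (inord 1 : 'I_3) = Ordinal (isT : (1 < 3)%N) by apply: val_inj; rewrite /= inordK.
have -> : (inord 2 : 'I_3) = Ordinal (isT : (2 < 3)%N) by apply: val_inj; rewrite /= inordK.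
case: i j ij => -[|[|[|//]]] ? [[|[|[|//]]] ?] //= _; congr (fun_of_matrix _ _ _);
  exact: val_inj.
Qed.

Lemma isomorphic_heisenberg : isomorphic (phi @` U12_23) heisenberg.
Proof.
rewrite phi_U12_23; exists heis_of_loop; last first.
  move=> M M' [a [b [c E]]] [a' [b' [c' E']]]; apply: val_inj.
  change (SLval (heis_of_loop (M * M')%g) =
    SLval (heis_of_loop M) *m SLval (heis_of_loop M')).
  rewrite (heis_of_loopE E) (heis_of_loopE E').
  rewrite (@heis_of_loopE _ (a + a') (b + b') (c + c' + b * a')); last first.
    by rewrite /= E E' heis_loop_mxM.
  by rewrite mx3M; do ![congr (mx3 _) | congr (_ :: _)]; ring.
split.
- move=> M [a [b [c E]]] i j ji; rewrite (heis_of_loopE E) !mxE.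
  by case: i j ji => -[|[|[|//]]] ? [[|[|[|//]]] ?].
- move=> M M' /set_mem[a [b [c E]]] /set_mem[a' [b' [c' E']]] /(congr1 (@SLval _ _)).
  rewrite (heis_of_loopE E) (heis_of_loopE E') => /matrixP H; apply: val_inj.
  rewrite /= E E'.
  have := H 0 (inord 1); have := H 0 (inord 2); have := H (inord 1) (inord 2).
  by rewrite !mxE /= !inordK //= => -> -> ->.
move=> A hA;
have [g Ug Eg] :=
  heis_loop_lift (A (inord 1) (inord 2)) (A 0 (inord 1)) (A 0 (inord 2)).
exists (phi g); first by do 3!eexists; exact: Eg.
by apply: val_inj; rewrite [LHS](heis_of_loopE Eg); apply/esym/heisenbergE.
Qed.

Local Open Scope group_scope.

(** The image of [Z_12, Z_23] is central in the Heisenberg image, so the double commutator lies in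
    the kernel, which is the residual. *)
Lemma commutator_Z_residual :
  commutator (commutator U1 U2) (commutator (commutator U1 U2) (commutator U2 U3))
    `<=` nilpotent_residual U_A2t.
Proof.
have sK := (ker_normal phi).1.
rewrite -ker_phi_residual commutator12E commutator23E; apply: generated_sub => //.
move=> _ [_ [a _ <-] [y Cy <-]].
suff [c Ec] : exists c, SLval (phi y) = heis_loop_mx 0 0 c.
  rewrite /ker /= gmulfR; apply/eqP/commgP/val_inj => /=.
  rewrite Ec phi_zgen !heis_loop_mxM; congr heis_loop_mx; ring.
move: y Cy; apply: (@generated_sub _ _ [set y | exists c, SLval (phi y) = heis_loop_mx 0 0 c]).
  split=> [|y y' [c Ec] [c' Ec']].
    by exists 0%R; rewrite gmulf1 /= mx3_1 /heis_loop_mx !scale0r polyC0.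
  (* A lift g of the matrix with parameter -c' serves to identify the inverse of phi(y'). *)
  exists (c - c')%R; have [g _ Eg] := heis_loop_lift 0 0 (- c').
  have -> : phi (y / y') = phi y * phi g.
    rewrite gmulfF; congr (_ * _); apply: mulg1_eq; apply: val_inj.
    rewrite /= Ec' Eg heis_loop_mxM mx3_1 /heis_loop_mx.
    by rewrite !addr0 subrr !scale0r polyC0.
  by rewrite /= Ec Eg heis_loop_mxM; congr heis_loop_mx; ring.
move=> _ [_ [b _ <-] [_ [d _ <-] <-]].
have zV e (x : rat) : (zgen e x)^-1 = zgen e (- x)%R.
  exact/esym/(gmulfV (zgen e) x).
have -> : [~ zgen false b, zgen true d] =
    zgen false (- (b : rat))%R * (zgen true (- (d : rat))%R * (zgen false b * zgen true d)).
  by rewrite -!zV.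
exists (- ((b : rat) * (d : rat)))%R.
rewrite /= (phi_mulE (phi_zgen _ _) (phi_mulE (phi_zgen _ _)
  (phi_mulE (phi_zgen _ _) (phi_zgen _ _)))).
by rewrite !heis_loop_mxM; congr heis_loop_mx; ring.
Qed.

Lemma commutator_Z_nontrivial :
  commutator (commutator U1 U2) (commutator (commutator U1 U2) (commutator U2 U3)) <> [set 1].
Proof.
rewrite commutator12E commutator23E => E.
have : [~ zgen false (1 : rat)%R, [~ zgen false (1 : rat)%R, zgen true (1 : rat)%R]] = 1.
  change ([set 1] [~ zgen false (1 : rat)%R, [~ zgen false (1 : rat)%R, zgen true (1 : rat)%R]]).
  rewrite -E; apply: sub_generated; exists (zgen false (1 : rat)%R); first by exists (1 : rat)%R.
  exists [~ zgen false (1 : rat)%R, zgen true (1 : rat)%R] => //.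
  apply: sub_generated; exists (zgen false (1 : rat)%R); first by exists (1 : rat)%R.
  by exists (zgen true (1 : rat)%R) => //; exists (1 : rat)%R.
pose l b (a : rat) := @letter _ (fun _ : bool => Qadd) b a.
(* The reduced word obtained by expanding [x, [x, y]] and cancelling one pair: x^-1 y^-1 x^-1 y x
   y^-1 x y. *)
pose w := [:: l false (-1)%R; l true (-1)%R; l false (-1)%R; l true 1%R;
  l false 1%R; l true (-1)%R; l false 1%R; l true 1%R].
have zV b : zgen b (-1 : rat)%R = (zgen b (1 : rat)%R)^-1.
  exact: (gmulfV (zgen b) (1 : rat)%R).
suff -> : [~ zgen false (1 : rat)%R, [~ zgen false (1 : rat)%R, zgen true (1 : rat)%R]] = zword w.
  exact: zword_neq1.
rewrite /zword /w !big_cons big_nil /= !zV mulg1.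
move: (zgen false _) (zgen true _) => x y.
by rewrite /commg /conjg !(invgM, invgK) -!mulgA mulVKg.
Qed.

(** Quotient maps carry gamma_n into gamma_n, so a nontrivial element of the residual dies in every
    nilpotent quotient. *)
Lemma not_residually_nilpotent : ~ residually_nilpotent U_A2t.
Proof.
move=> rn.
have [g Cg g1] : exists2 g, nilpotent_residual U_A2t g & g <> 1.
  apply: contrapT => H; apply: commutator_Z_nontrivial; apply/seteqP; split=> [g Cg|_ ->].
    by apply: contrapT => g1; apply: H; exists g => //; apply: commutator_Z_residual.
  exact: (generated_subgroup _).1.
have [N [n n0 Ln] []] := rn g g1.
have LN m (h : U_A2t) : lcs U_A2t m h -> lcs (quotient_group N) m (quotient_map N h).
  case: m => // m; elim: m h => // m IHm h; move: h; apply: generated_sub.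
    have sN := lcs_subgroup (quotient_group N) m.+2.
    split=> [|x y Lx Ly]; first by rewrite /mkset gmulf1; exact: sN.1.
    by rewrite /mkset gmulfF; apply: sN.2; [exact: Lx | exact: Ly].
  move=> _ [x _ [y Ly <-]]; rewrite /mkset gmulfR; apply: sub_generated.
  by exists (quotient_map N x) => //; exists (quotient_map N y) => //; apply: IHm.
change ([set 1] (quotient_map N g)); rewrite -Ln; apply: LN; exact: Cg.
Qed.

End Conclusion.

Local Open Scope classical_set_scope.
Local Open Scope group_scope.

Theorem theorem2 :
  [/\ ker phi = nilpotent_residual U_A2t,
      [/\ isomorphic (commutator U1 U2) [set: Qadd],
          isomorphic (commutator U2 U3) [set: Qadd],
          isomorphic U12_23 [set: Q_free_Q]
        & isomorphic (phi @` U12_23) heisenberg],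
      commutator (commutator U1 U2)
        (commutator (commutator U1 U2) (commutator U2 U3))
        `<=` nilpotent_residual U_A2t,
      commutator (commutator U1 U2)
        (commutator (commutator U1 U2) (commutator U2 U3)) <> [set 1]
    & ~ residually_nilpotent U_A2t].
Proof.
split.
- exact: ker_phi_residual.
- split.
  + by apply: isomorphic_range (@zgen_inj false) _; rewrite commutator12E.
  + by apply: isomorphic_range (@zgen_inj true) _; rewrite commutator23E.
  + exact: isomorphic_range zfree_inj range_zfree.
  + exact: isomorphic_heisenberg.
- exact: commutator_Z_residual.
- exact: commutator_Z_nontrivial.
- exact: not_residually_nilpotent.
Qed.
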